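(* Suppose ${\bf E}\,\xi^-=\infty$ and $$\int_0^\infty \frac{x}{m(x)}\,F(dx)<\infty .$$ Let the distribution $F$ be long-tailed and let the distribution $G_1$ on $[0,\infty)$ with tail $$\overline G_1(x)=\min\Biggl(1,\int_0^\infty \overline F(x+t)\,d\frac{t}{m(t)}\Biggr),\quad x\ge 0,$$ be subexponential. Then $$1\le \liminf_{x\to\infty}\frac{{\bf P}\{M>x\}}{\overline G_1(x)}\le \limsup_{x\to\infty}\frac{{\bf P}\{M>x\}}{\overline G_1(x)}\le 2 .$$
   Context: Let $\xi,\xi_1,\xi_2,\ldots$ be independent real random variables with common non-degenerate distribution $F$ on ${\bf R}$. For a distribution $G$, write $G(x)=G((-\infty,x])$ and $\overline G(x)=G((x,\infty))$. Put $S_0=0$, $S_n=\xi_1+\cdots+\xi_n$, $M=\sup\{S_n: n\ge 0\}$. Let $\xi^-=\max\{-\xi,0\}$ and let $$m(x)={\bf E}\min\{\xi^-,x\}=\int_0^x{\bf P}\{\xi^->y\}\,dy,\quad x\ge 0,$$ be the negative truncated mean function. The function $t\mapsto t/m(t)$ is continuous and nondecreasing on $(0,\infty)$, and integrals against $d\frac{t}{m(t)}$ are Lebesgue–Stieltjes integrals over $(0,\infty)$. (When ${\bf E}\xi^-=\infty$, finiteness of $\int_0^\infty \frac{x}{m(x)}F(dx)$ is equivalent to $M<\infty$ a.s.) A distribution $G$ is long-tailed if, for every fixed $t$, $\overline G(x+t)/\overline G(x)\to 1$ as $x\to\infty$ (in particular $\overline G(x)>0$ for all $x$). A distribution $G$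 on $[0,\infty)$ with unbounded support is subexponential if $\overline{G*G}(x)\sim 2\overline G(x)$ as $x\to\infty$, where $*$ denotes convolution and $f\sim g$ means $f/g\to 1$. *)

(* Defs.v *)
From HB Require Import structures.
From mathcomp Require Import all_boot all_order all_algebra.
From mathcomp Require Import all_classical all_reals all_analysis.
From mathcomp Require Import measurable_realfun.

Set Implicit Arguments.
Unset Strict Implicit.
Unset Printing Implicit Defensive.

Import Order.TTheory GRing.Theory Num.Theory.
Import numFieldNormedType.Exports.

Local Open Scope classical_set_scope.
Local Open Scope ring_scope.

Definition mutually_independent (d : measure_display) (T : measurableType d)
    (R : realType) (P : probability T R) (X : nat -> {RV P >-> R}) : Prop :=
  forall (J : seq nat) (A : nat -> set R), uniq J ->
    (forall i, measurable (A i)) ->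
    P (\bigcap_(i in [set` J]) (X i @^-1` A i)) =
      (\prod_(i <- J) P (X i @^-1` A i))%E.

(* The laws are compared on Borel sets only: as functions on all of [set R],
   two measures with the same law may differ on non-measurable sets. *)
Definition has_law (d : measure_display) (T : measurableType d) (R : realType)
    (P : probability T R) (X : {RV P >-> R}) (F : probability R R) : Prop :=
  forall A : set R, measurable A -> distribution P X A = F A.

Definition nondegenerate_law (R : realType) (F : probability R R) : Prop :=
  forall c : R, F [set c] <> 1%E.

Definition tail (R : realType) (G : probability R R) (x : R) : R :=
  fine (G `]x, +oo[%classic).

Definition long_tailed (R : realType) (G : probability R R) : Prop :=
  forall t : R, tail G (x + t) / tail G x @[x --> +oo] --> (1 : R).

Definition convolution (R : realType) (G H : probability R R) :
    set R -> \bar R :=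
  pushforward (G \x H)%E (fun z : R * R => z.1 + z.2).

Definition subexponential (R : realType) (G : probability R R) : Prop :=
  [/\ G `]-oo, 0[%classic = 0%E,
      forall x : R, 0 < tail G x
    & fine (convolution G G `]x, +oo[%classic) / (2 * tail G x) @[x --> +oo]
        --> (1 : R)].

Definition neg_part (R : realType) (y : R) : R := Num.max (- y) 0.

(* [E min(xi^-, x)] for [xi] of law [F], the expectation being taken on the
   canonical space [(R, F)], on which the identity has law [F]. *)
Definition neg_tmean (R : realType) (F : probability R R) (x : R) : R :=
  fine ('E_F[fun y : R => Num.min (neg_part y) x])%E.

Section neg_tmean_theory.
Variables (R : realType) (F : probability R R).
Local Notation m := (neg_tmean F).

Let h (x : R) := fun y : R => Num.min (neg_part y) x.

Let mh x : measurable_fun [set: R] (h x).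
Proof.
apply: measurable_minr; last exact: measurable_cst.
by apply: measurable_maxr; [exact: measurable_funN|exact: measurable_cst].
Qed.

Let neg_part_ge0 (y : R) : 0 <= neg_part y.
Proof. by rewrite /neg_part le_max lexx orbT. Qed.

Let h_ge0 (x y : R) : 0 <= x -> 0 <= h x y.
Proof. by move=> x0; rewrite /h le_min neg_part_ge0. Qed.

Let Eh_ge0 (x : R) : 0 <= x -> (0 <= 'E_F[h x])%E.
Proof. by move=> x0; apply: expectation_ge0 => y; exact: h_ge0. Qed.

Let Eh_fin (x : R) : 0 <= x -> ('E_F[h x])%E \is a fin_num.
Proof.
move=> x0; rewrite ge0_fin_numE ?Eh_ge0//.
apply: (@le_lt_trans _ _ ('E_F[cst x])%E); last by rewrite expectation_cst ltry.
apply: expectation_le => //.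
- by move=> y; exact: h_ge0.
- by apply: aeW => y; rewrite /h /= ge_min lexx orbT.
Qed.

Let m_E (x : R) : 0 <= x -> (m x)%:E = ('E_F[h x])%E.
Proof. by move=> x0; rewrite /neg_tmean fineK// Eh_fin. Qed.

Lemma neg_tmean_ge0 (x : R) : 0 <= x -> 0 <= m x.
Proof. by move=> x0; rewrite -lee_fin m_E// Eh_ge0. Qed.

Lemma neg_tmean_le (s t : R) : 0 <= s -> s <= t -> m s <= m t.
Proof.
move=> s0 st; have t0 := le_trans s0 st.
rewrite -lee_fin !m_E//; apply: expectation_le => //.
- by move=> y; exact: h_ge0.
- by move=> y; exact: h_ge0.
- by apply: aeW => y; rewrite /h le_min !ge_min lexx st orbT.
Qed.

Lemma neg_tmean_div_le (s t : R) : 0 < s -> s <= t -> m t <= t / s * m s.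
Proof.
move=> s0 st; have t0 := lt_le_trans s0 st.
have ts0 : 0 <= t / s by rewrite divr_ge0// ltW.
have hZ y : 0 <= t / s * h s y by rewrite mulr_ge0// h_ge0// ltW.
rewrite -lee_fin EFinM !m_E ?(ltW s0) ?(ltW t0)//.
have -> : ((t / s)%:E * 'E_F[h s] = 'E_F[fun y => (t / s * h s y)%R])%E.
  rewrite !unlock; under [in RHS]eq_integral do rewrite EFinM.
  rewrite ge0_integralZl_EFin//.
  - by move=> y _; rewrite lee_fin h_ge0// ltW.
  - by apply/measurable_EFinP; exact: mh.
apply: expectation_le => //.
- by apply: measurable_funM; [exact: measurable_cst|exact: mh].
- by move=> y; rewrite h_ge0// ltW.
- apply: aeW => y; rewrite /h minr_pMr// le_min !ge_min.
  rewrite divfK ?gt_eqF// lexx orbT andbT; apply/orP; left.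
  by rewrite ler_peMl// ler_pdivlMr// mul1r.
Qed.

(* [t / m(t)] for [t > 0], continued to [t <= 0] by its right limit at [0], so
   that it is right-continuous on [R] and the associated measure has no mass
   on [`]-oo, 0]]. *)
Definition neg_ratio (t : R) : R :=
  if 0 < t then t / m t else inf [set s / m s | s in `]0, +oo[].

Let ratio_le (s t : R) : 0 < s -> s <= t -> s / m s <= t / m t.
Proof.
move=> s0 st; have t0 := lt_le_trans s0 st.
have := neg_tmean_ge0 (ltW s0); rewrite le_eqVlt => /predU1P[ms0|ms0].
  by rewrite -ms0 invr0 mulr0 divr_ge0 ?neg_tmean_ge0// ltW.
have mt0 : 0 < m t by rewrite (lt_le_trans ms0)// neg_tmean_le// ltW.
rewrite ler_pdivrMr// mulrAC ler_pdivlMr//.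
rewrite mulrC -ler_pdivlMr// mulrAC.
exact: neg_tmean_div_le.
Qed.

Let lb0 : lbound [set s / m s | s in `]0, +oo[] 0.
Proof.
move=> _ [s /= + <-]; rewrite in_itv/= andbT => s0.
by rewrite divr_ge0 ?neg_tmean_ge0// ltW.
Qed.

Let has_inf_ratio : has_inf [set s / m s | s in `]0, +oo[].
Proof.
split; last by exists 0.
by exists (1 / m 1); exists 1 => //=; rewrite in_itv/= ltr01.
Qed.

Let inf_ratio_le t : 0 < t -> inf [set s / m s | s in `]0, +oo[] <= t / m t.
Proof.
move=> t0; apply: ge_inf; first by exists 0.
by exists t => //=; rewrite in_itv/= t0.
Qed.

Lemma neg_ratio_nd : {homo neg_ratio : s t / s <= t}.
Proof.
move=> s t st; rewrite /neg_ratio; case: ifPn => s0.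
  by rewrite (lt_le_trans s0 st) ratio_le.
by case: ifPn => // t0; exact: inf_ratio_le.
Qed.

Lemma neg_ratio_rc (x : R) : neg_ratio t @[t --> x^'+] --> neg_ratio x.
Proof.
have [x0|x0|->] := ltgtP x 0.
- apply/cvgrPdist_lt => e e0; near=> t.
  rewrite /neg_ratio !ifF ?subrr ?normr0//; apply/negbTE; rewrite -leNgt.
  + near: t; exact: nbhs_right_le.
  + exact: ltW.
- apply: (@squeeze_cvgr _ _ _ _ (cst (x / m x)) (fun t => t / m x)).
  + near=> t; have xt : x < t by near: t; exact: nbhs_right_gt.
    rewrite /neg_ratio (lt_trans x0 xt) /= ratio_le ?(ltW xt)//=.
    have := neg_tmean_ge0 (ltW x0); rewrite le_eqVlt => /predU1P[mx0|mx0].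
      have : m t <= 0.
        by rewrite (le_trans (neg_tmean_div_le x0 (ltW xt)))// -mx0 mulr0.
      move=> mt; have -> : m t = 0.
        by apply/eqP; rewrite eq_le mt neg_tmean_ge0// ltW// (lt_trans x0).
      by rewrite -mx0.
    rewrite ler_pM2l ?(lt_trans x0 xt)// lef_pV2 ?posrE//.
      by rewrite neg_tmean_le// ltW.
    by rewrite (lt_le_trans mx0)// neg_tmean_le// ltW.
  + rewrite /neg_ratio x0; exact: cvg_cst.
  + rewrite /neg_ratio x0; apply: cvgMr_tmp.
    exact/cvg_at_right_filter/cvg_id.
- apply/cvgrPdist_lt => e e0.
  have [_ [s /= + <-] sle] := inf_adherent e0 has_inf_ratio.
  rewrite in_itv/= andbT => s0.
  near=> t; have t0 : 0 < t by near: t; exact: nbhs_right_gt.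
  have ts : t <= s by near: t; exact: nbhs_right_le.
  rewrite /neg_ratio ltxx t0 distrC ger0_norm ?subr_ge0 ?inf_ratio_le//.
  by rewrite ltrBlDl (le_lt_trans _ sle)// ratio_le.
Unshelve. all: by end_near. Qed.

HB.instance Definition _ :=
  isCumulative.Build R _ R neg_ratio neg_ratio_nd neg_ratio_rc.

End neg_tmean_theory.

Definition walk (d : measure_display) (T : measurableType d) (R : realType)
    (P : probability T R) (xi : nat -> {RV P >-> R}) (n : nat) (w : T) : R :=
  \sum_(i < n) xi i w.

Definition walk_sup (d : measure_display) (T : measurableType d)
    (R : realType) (P : probability T R) (xi : nat -> {RV P >-> R}) (w : T) :
    \bar R :=
  ereal_sup [set (walk xi n w)%:E | n in [set: nat]].

(* Main.v *)
Require Import Defs.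
From HB Require Import structures.
From mathcomp Require Import all_boot all_order all_algebra.
From mathcomp Require Import all_classical all_reals all_analysis.
From mathcomp Require Import measurable_realfun.
From mathcomp Require Import ring lra.

(** Write m for the negative truncated mean, a(t) = t / m(t), v(x) = P(M > x),
    and J(x) for the integral of a(y - x) over y > x with respect to F(dy).
    Exchanging the order of integration turns the integral that defines G1 into
    J(x), up to a multiple of F(]x, oo[) that is negligible because F is
    long-tailed and a is unbounded.

    The walk passes a high level x by one big jump, made from the depth -t that
    it has reached, so v(x) is about the integral of F(]x + t, oo[) against the
    Green measure of the walk.  When its negative jumps are truncated at t, the
    walk loses about m(t) per step and has lost between t and 2t when it leaves
    [-t, 0]; hence the Green measure of [-t, 0] is asymptotically between a(t)
    and 2 a(t), and these two constants are the ones of the theorem.  Positive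
    jumps that do not pass the level are negligible here, since their truncated
    mean is o(m(t)) (pos_tmean_small).

    The proof does not use the Green measure itself, nor ladder heights, but
    comparison of functions.  By Lindley's recursion (walk_sup_tail_sup_tail), v
    is the smallest nonnegative function that equals 1 on the negative half-line
    and is at least its own mean after one step elsewhere (record sup_tail); each
    bound on v then follows from a comparison with an explicit function.

    Lower bound (sup_tail_lower).  The function min(s, (z + s)^+) of the
    position z loses on average at most m(s) in one step, and nothing if z <= -s.
    Divided by m(s), and integrated over the excess s = y - x of a jump y over x,
    it becomes jump_mean, whose loss is at most the probability that the next
    jump passes x, and whose value at 0 is J(x).  It follows that
    J(x) <= (1 + J(x)) v(x) for every x >= 0.

    Upper bound (sup_tail_upper).
    - v tends to 0 (sup_tail_small).  The integral of (2 s - x)^+ / m(s) against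
      a measure E(ds) loses on average at least E(]x, oo[) by the negative part of
      one step, and its slope is at most E(]x / 2, oo[) / m(x / 2).  Taking for E
      a mixture of dilations of F, whose tail dominates that of F at x / 2 but
      grows at most by a constant factor when x is divided by 4, this loss
      exceeds the gain by positive jumps.
    - Since v(K) is small for some K, returns from below -t - K to above -t can
      be neglected, and the bound 2 a(t) holds for the walk killed above K, up to
      a factor close to 1 (green_excessive).
    - The path is cut at its first passage above K (stage_inequality).  The
      position after that passage has tail at most about 2 J, and from there on
      the walk has to pass the remaining height; if v <= q G1, then the passages
      that do not exceed x at once contribute a small multiple of q G1(x), by
      subexponentiality and because v(K) is small.  This shows first that v is
      O(G1), and then that v <= (2 + e) G1 eventually. *)

Set Implicit Arguments.
Unset Strict Implicit.
Unset Printing Implicit Defensive.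

Import Order.TTheory GRing.Theory Num.Theory.
Import numFieldNormedType.Exports.

Local Open Scope classical_set_scope.
Local Open Scope ring_scope.

Local Notation ray x := (`]x%R, +oo[%classic).

(** * Truncated means *)

Section truncated_means.
Variables (R : realType) (F : probability R R).
Local Notation m := (neg_tmean F).

Definition pos_tmean (x : R) : R :=
  fine (\int[F]_y (Num.min (Num.max y 0) x)%:E).

(** The value 0 on the negative half-line makes the function monotone on the
    whole line, hence measurable. *)
Definition ratio0 (t : R) : R := if 0 < t then t / m t else 0.

Lemma measurable_neg_part : measurable_fun [set: R] (@neg_part R).
Proof. by apply: measurable_maxr;
  [exact: measurable_funN|exact: measurable_cst]. Qed.

Lemma neg_part_ge0 (y : R) : 0 <= neg_part y.
Proof. by rewrite /neg_part le_max lexx orbT. Qed.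

Lemma fin_num_integral_le (f : R -> R) (c : R) :
  measurable_fun [set: R] f -> (forall y, 0 <= f y <= c) ->
  (\int[F]_y (f y)%:E)%E \is a fin_num /\ (\int[F]_y (f y)%:E <= c%:E)%E.
Proof.
move=> mf fc.
have le : (\int[F]_y (f y)%:E <= c%:E)%E.
  have -> : c%:E = (\int[F]_y (cst c%:E y))%E.
    by rewrite integral_cst//= -[F _]/(F [set: R]) probability_setT mule1.
  apply: ge0_le_integral => //.
  - by move=> y _; rewrite lee_fin; case/andP: (fc y).
  - exact/measurable_EFinP.
  - by move=> y _; rewrite lee_fin; case/andP: (fc y).
split=> //; rewrite ge0_fin_numE ?(le_lt_trans le) ?ltry//.
by apply: integral_ge0 => y _; rewrite lee_fin; case/andP: (fc y).
Qed.

Lemma neg_tmeanE (x : R) : 0 <= x ->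
  (m x)%:E = (\int[F]_y (Num.min (neg_part y) x)%:E)%E.
Proof.
move=> x0; rewrite /neg_tmean unlock fineK//.
apply: (proj1 (fin_num_integral_le (c := x) _ _)).
  by apply: measurable_minr; [exact: measurable_neg_part|exact: measurable_cst].
by move=> y; rewrite le_min neg_part_ge0 x0 ge_min lexx orbT.
Qed.

Lemma pos_tmeanE (x : R) : 0 <= x ->
  (pos_tmean x)%:E = (\int[F]_y (Num.min (Num.max y 0) x)%:E)%E.
Proof.
move=> x0; rewrite /pos_tmean fineK//.
apply: (proj1 (fin_num_integral_le (c := x) _ _)).
  apply: measurable_minr; last exact: measurable_cst.
  by apply: measurable_maxr => //; exact: measurable_cst.
by move=> y; rewrite le_min x0 le_max lexx orbT /= ge_min lexx orbT.
Qed.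

Lemma pos_tmean_ge0 (x : R) : 0 <= x -> 0 <= pos_tmean x.
Proof.
move=> x0; rewrite -lee_fin pos_tmeanE//; apply: integral_ge0 => y _.
by rewrite lee_fin le_min x0 le_max lexx orbT.
Qed.

End truncated_means.

(** Structural decomposition of measurability goals; measurability hypotheses in
    the context are used both directly and through composition. *)
Ltac mfun1 :=
  match goal with
  | H : ?G |- ?G => exact H
  | |- measurable_fun _ (fun _ => ?c) => exact: measurable_cst
  | |- measurable_fun _ (cst _) => exact: measurable_cst
  | |- measurable_fun _ (fun x => x) => exact: measurable_id
  | |- measurable_fun _ (fun x => fst x) => exact: measurable_fst
  | |- measurable_fun _ (fun x => snd x) => exact: measurable_snd
  | |- measurable_fun _ fst => exact: measurable_fst
  | |- measurable_fun _ snd => exact: measurable_snd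
  | H : measurable_fun [set: _] ?f |- measurable_fun _ (fun x => ?f (@?g x)) =>
      apply: (measurableT_comp H)
  | |- measurable_fun _ (fun x => EFin (@?f x)) => apply/measurable_EFinP
  | |- measurable_fun _ (EFin \o _) => apply/measurable_EFinP
  | |- measurable_fun _ (fun x => if @?f x then _ else _) =>
    apply: measurable_fun_ifT
  | |- measurable_fun _ (fun x => (@?f x < @?g x)%R) => apply: measurable_fun_ltr
  | |- measurable_fun _ (fun x => (@?f x <= @?g x)%R) => apply: measurable_fun_ler
  | |- measurable_fun _ (@Order.lt _ _ ?c) =>
      apply: (measurable_fun_ltr (f := cst c) (g := fun x => x))
  | |- measurable_fun _ (@Order.le _ _ ?c) =>
      apply: (measurable_fun_ler (f := cst c) (g := fun x => x))
  | |- measurable_fun _ (+%R ?c) =>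
      apply: (measurable_funD (f := cst c) (g := fun x => x))
  | |- measurable_fun _ ( *%R ?c) =>
      apply: (measurable_funM (f := cst c) (g := fun x => x))
  | |- measurable_fun _ (fun x => @?f x && @?g x) => apply: measurable_and
  | |- measurable_fun _ (fun x => Order.min (@?f x) (@?g x)) =>
    apply: measurable_minr
  | |- measurable_fun _ (fun x => Order.max (@?f x) (@?g x)) =>
    apply: measurable_maxr
  | |- measurable_fun _ (fun x => (@?f x + - @?g x)%R) => apply: measurable_funB
  | |- measurable_fun _ (fun x => (@?f x + @?g x)%R) =>
      first [apply: measurable_funD | apply: emeasurable_funD]
  | |- measurable_fun _ (fun x => (- @?f x)%R) => apply: measurableT_comp;
    [exact: oppr_measurable|]
  | |- measurable_fun _ (fun x => (@?f x * @?g x)%R) => apply: measurable_funM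
  | |- measurable_fun _ (fun x => (?c * @?g x)%E) => apply: measurable_funeM
  | |- measurable_fun _ (fun x => (@?f x * @?g x)%E) => apply: emeasurable_funM
  | |- measurable_fun _ (fun x => powR (@?f x) ?p) =>
      apply: (measurableT_comp (measurable_powR p))
  | |- measurable_fun _ (fun x => neg_part (@?f x)) =>
      apply: (measurableT_comp (@measurable_neg_part _))
  | |- measurable_fun _ (@neg_part _) => exact: measurable_neg_part
  end.
Ltac mfun := repeat mfun1.

Lemma tail_integral_small (d : measure_display) (T : measurableType d)
    (R : realType) (mu : {measure set T -> \bar R}) (k : T -> R)
    (f : T -> \bar R) (e : R) :
  measurable_fun setT k -> measurable_fun setT f -> (forall y, 0 <= f y)%E ->
  (\int[mu]_y f y < +oo)%E -> 0 < e ->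
  exists2 c0 : R, 0 < c0 & forall c, c0 <= c ->
    (\int[mu]_y (if (c < k y)%R then f y else 0) <= e%:E)%E.
Proof.
move=> mk mf f0 foo e0.
pose g (n : nat) y : \bar R := if k y <= n%:R then f y else 0%E.
have mg n : measurable_fun setT (g n) by rewrite /g; mfun.
have g0 n y : (0 <= g n y)%E by rewrite /g; case: ifP.
have lg y : limn (g^~ y) = f y.
  apply: lim_near_cst => //; near=> n; rewrite /g ifT//.
  by near: n; exact: nbhs_infty_ger.
have := @cvg_monotone_convergence _ _ _ mu _ measurableT g mg (fun n y _ => g0 n y).
have h : forall x : T, setT x -> {homo g^~ x : n m / (n <= m)%N >-> (n <= m)%E}.
  move=> y _ n m' nm; rewrite /g; case: ifPn => kn; last by case: ifP.
  by rewrite ifT// (le_trans kn)// ler_nat.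
move/(_ h); under eq_integral do rewrite lg.
set I := (\int[mu]_x f x)%E in foo *.
have If : I \is a fin_num.
  by rewrite ge0_fin_numE//; apply: integral_ge0.
have -> : I = (fine I)%:E by rewrite fineK.
move/fine_cvgP => [_ /cvgrPdist_lt /(_ e e0)] [N _ /(_ N (leqnn _))] /= HN.
exists N.+1%:R; first by rewrite ltr0n.
move=> c Nc.
have mh : measurable_fun setT (fun y => if (c < k y)%R then f y else 0%E) by mfun.
have le1 : (\int[mu]_y g N y + \int[mu]_y (if
  (c < k y)%R then f y else 0%E) <= I)%E.
  rewrite -ge0_integralD//; last by move=> y _; case: ifP.
  apply: ge0_le_integral => //.
  - by move=> y _; rewrite adde_ge0//; case: ifP.
  - exact: emeasurable_funD.
  - move=> y _; rewrite /g; case: ifPn => kn; case: ifPn => kc;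
    rewrite ?adde0 ?add0e//.
    have := lt_le_trans kc kn; rewrite ltNge (le_trans _ Nc)// ler_nat//.
have gf : (\int[mu]_y g N y)%E \is a fin_num.
  rewrite ge0_fin_numE; last exact: integral_ge0.
  apply: le_lt_trans foo; apply: le_trans le1.
  by rewrite leeDl//; apply: integral_ge0 => y _; case: ifP.
rewrite -(leeD2lE _ _ gf) (le_trans le1)// -(fineK If) -(fineK gf) -EFinD lee_fin.
rewrite -lerBlDl ltW//; exact: le_lt_trans (ler_norm _) HN.
Unshelve. all: by end_near. Qed.

Section truncated_means_infinite.
Variables (R : realType) (F : probability R R).
Local Notation m := (neg_tmean F).
Hypothesis infinite_mean : ('E_F[@neg_part R] = +oo)%E.

Lemma neg_tmean_infty
  (c : R) : exists2 x0 : R, 0 < x0 & forall x, x0 <= x -> c <= m x.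
Proof.
pose g (n : nat) y : \bar R := (Num.min (@neg_part R y) n%:R)%:E.
have mg n : measurable_fun [set: R] (g n) by rewrite /g; mfun.
have g0 n y : (0 <= g n y)%E by rewrite lee_fin le_min neg_part_ge0 ler0n.
have lg y : limn (g^~ y) = (neg_part y)%:E.
  apply: lim_near_cst => //; near=> n; rewrite /g min_l//.
  by near: n; exact: nbhs_infty_ger.
have := @cvg_monotone_convergence _ _ _ F _ measurableT g mg (fun n y _ => g0 n y).
have h : forall x : R, setT x -> {homo g^~ x : n m / (n <= m)%N >-> (n <= m)%E}.
  move=> y _ n p np; rewrite lee_fin le_min !ge_min lexx /=.
  by rewrite ler_nat np orbT.
move/(_ h); under eq_integral do rewrite lg.
move: infinite_mean; rewrite unlock => ->.
move/cvgeyPge => /(_ c) [N _ /(_ N (leqnn _))] /=.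
rewrite -neg_tmeanE ?ler0n// lee_fin => HN.
exists N.+1%:R; first by rewrite ltr0n.
move=> x Nx; rewrite (le_trans HN)// neg_tmean_le ?ler0n// (le_trans _ Nx)//.
by rewrite ler_nat.
Unshelve. all: by end_near. Qed.

Lemma neg_tmean_gt0 (x : R) : 0 < x -> 0 < m x.
Proof.
move=> x0; rewrite lt_neqAle neg_tmean_ge0 ?(ltW x0)// andbT eq_sym.
apply/eqP => mx; have [y y0 /(_ (Num.max x y))] := neg_tmean_infty 1.
rewrite le_max lexx orbT => /(_ erefl); apply/negP; rewrite -ltNge.
apply: (le_lt_trans (neg_tmean_div_le F x0 _)); first by rewrite le_max lexx.
by rewrite mx mulr0.
Qed.

Lemma ratio0_ge0 t : 0 <= ratio0 F t.
Proof.
by rewrite /ratio0; case: ifPn => // t0; rewrite divr_ge0 ?neg_tmean_ge0// ltW.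
Qed.

Lemma ratio0_gt0 t : 0 < t -> 0 < ratio0 F t.
Proof. by move=> t0; rewrite /ratio0 t0 divr_gt0// neg_tmean_gt0. Qed.

Lemma ratio0M c t : 1 <= c -> ratio0 F (c * t) <= c * ratio0 F t.
Proof.
move=> c1; have c0 : 0 < c by rewrite (lt_le_trans _ c1).
rewrite /ratio0 pmulr_rgt0//; case: ifPn => t0; last by rewrite mulr0.
rewrite -mulrA ler_pM2l// ler_pM2l// lef_pV2 ?posrE ?neg_tmean_gt0 ?mulr_gt0//.
by rewrite neg_tmean_le ?ler_peMl// ltW.
Qed.

Lemma ratio0_nd : {homo ratio0 F : s t / s <= t}.
Proof.
move=> s t st; rewrite {1}/ratio0; case: ifPn => s0; last exact: ratio0_ge0.
rewrite /ratio0 (lt_le_trans s0 st) ler_pdivrMr ?neg_tmean_gt0//.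
rewrite mulrAC ler_pdivlMr ?neg_tmean_gt0 ?(lt_le_trans s0)//.
have h := neg_tmean_div_le F s0 st; rewrite -(ler_pM2l s0) in h.
by rewrite (le_trans h)// mulrA mulrCA divff ?gt_eqF// mulr1.
Qed.

Lemma measurable_ratio0 : measurable_fun [set: R] (ratio0 F).
Proof. by apply: nondecreasing_measurable => //; exact: ratio0_nd. Qed.

(** Cutting at a level c gives m(x) <= c + x P(xi^- > c). *)
Lemma neg_tmean_sub (e : R) : 0 < e ->
  exists2 x0 : R, 0 < x0 & forall x, x0 <= x -> m x <= e * x.
Proof.
move=> e0; have e20 : 0 < e / 2 by rewrite divr_gt0.
have [c c0 hc] : exists2 c0 : R, 0 < c0 & forall c, c0 <= c ->
    (\int[F]_y (if (c < @neg_part R y)%R then 1 else 0) <= (e/2)%:E)%E.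
  apply: tail_integral_small => //; mfun.
  by rewrite integral_cst//= -[F _]/(F [set: R]) probability_setT mule1 ltry.
exists (2 * c / e); first by rewrite divr_gt0// mulr_gt0.
move=> x xc; have x0 : 0 < x by apply: lt_le_trans xc; rewrite divr_gt0// mulr_gt0.
have : ((m x)%:E <= c%:E + x%:E * (e/2)%:E)%E.
  rewrite neg_tmeanE ?(ltW x0)//.
  apply: (@le_trans _ _ (\int[F]_y (c%:E + x%:E * (if
    (c < neg_part y)%R then 1 else 0)))%E).
    apply: ge0_le_integral => //.
    - by move=> y _; rewrite lee_fin le_min neg_part_ge0 ltW.
    - by mfun.
    - mfun.
    - move=> y _; case: ifPn => hy.
        by rewrite mule1 -EFinD lee_fin ge_min; apply/orP; right;
          rewrite ler_wpDl// ltW.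
      by rewrite mule0 adde0 lee_fin ge_min leNgt hy.
  rewrite ge0_integralD//; last 3 first.
  - by move=> y _; rewrite lee_fin ltW.
  - by move=> y _; rewrite mule_ge0// ?lee_fin ?(ltW x0)//; case: ifP.
  - by mfun.
  rewrite integral_cst//= -[X in (c%:E * X)%E]/(F [set: R]) probability_setT mule1.
  rewrite leeD2l// ge0_integralZl//; last 3 first.
  - by mfun.
  - by move=> y _; case: ifP.
  - by rewrite lee_fin ltW.
  by rewrite lee_wpmul2l ?lee_fin ?(ltW x0)// hc.
rewrite -EFinM -EFinD lee_fin => /le_trans; apply.
move: xc; rewrite ler_pdivrMr// => xc.
by nra.
Qed.

Lemma ratio0_infty (c : R) : exists2 x0 : R, 0 < x0 & forall x, x0 <= x -> c <=
  ratio0 F x.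
Proof.
have e0 : 0 < (Num.max c 1)^-1 by rewrite invr_gt0 lt_max ltr01 orbT.
have [x0 x00 h] := neg_tmean_sub e0.
exists x0 => // x xx; have xp := lt_le_trans x00 xx.
rewrite /ratio0 xp ler_pdivlMr ?neg_tmean_gt0//.
apply: (@le_trans _ _ (Num.max c 1 * m x)).
  by rewrite ler_pM2r ?neg_tmean_gt0// le_max lexx.
by have := h _ xx; rewrite ler_pdivlMl// lt_max ltr01 orbT.
Qed.

Hypothesis ratio_integrable :
  (\int[F]_(x in `]0%R, +oo[) (x / neg_tmean F x)%:E < +oo)%E.

Lemma ratio0_integrable : (\int[F]_x (ratio0 F x)%:E < +oo)%E.
Proof.
move: ratio_integrable; rewrite integral_mkcond; congr (_ < _)%E.
apply: eq_integral => x _; rewrite patchE /ratio0.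
case: ifPn; first by rewrite inE /= in_itv/= andbT => ->.
by rewrite notin_setE /= in_itv/= andbT => /negP/negbTE ->.
Qed.

(** For y above a level c, min(y, x) / m(x) <= a(y), whether y <= x or not,
    because m and a are nondecreasing; so the mean of min(xi^+, x) / m(x) is
    at most c / m(x) plus a tail of the convergent integral of a. *)
Lemma pos_tmean_small (e : R) : 0 < e ->
  exists2 x0 : R, 0 < x0 & forall x, x0 <= x -> pos_tmean F x <= e * m x.
Proof.
move=> e0; have e20 : 0 < e / 2 by rewrite divr_gt0.
have [c c0 hc] : exists2 c0 : R, 0 < c0 & forall c, c0 <= c ->
    (\int[F]_y (if (c < y)%R then (ratio0 F y)%:E else 0) <= (e/2)%:E)%E.
  apply: tail_integral_small => //; mfun.
  - exact: measurable_ratio0.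
  - by move=> y; rewrite lee_fin ratio0_ge0.
  - exact: ratio0_integrable.
have [x1 x10 hx1] := neg_tmean_infty (2 * c / e).
exists x1 => // x xx; have x0 := lt_le_trans x10 xx.
have mx0 := neg_tmean_gt0 x0.
have : ((pos_tmean F x)%:E <= c%:E + (m x)%:E * (e/2)%:E)%E.
  rewrite pos_tmeanE ?(ltW x0)//.
  apply: (@le_trans _ _ (\int[F]_y (c%:E + (m x)%:E * (if (c < y)%R then
    (ratio0 F y)%:E else 0)))%E).
    apply: ge0_le_integral => //.
    - by move=> y _; rewrite lee_fin le_min (ltW x0) le_max lexx orbT.
    - by mfun.
    - by mfun; exact: measurable_ratio0.
    - move=> y _; case: ifPn => hy; last first.
        rewrite mule0 adde0 lee_fin ge_min; apply/orP; left.
        by rewrite ge_max leNgt hy ltW.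
      rewrite -EFinM -EFinD lee_fin ler_wpDl//; first exact: ltW.
      have y0 := lt_trans c0 hy.
      case: (leP y x) => yx.
        rewrite ge_min; apply/orP; left;
          rewrite ge_max mulr_ge0 ?ratio0_ge0 ?(ltW mx0)// andbT.
        rewrite /ratio0 y0 mulrA ler_pdivlMr ?neg_tmean_gt0// mulrC ler_pM2r//.
        by rewrite neg_tmean_le// ltW.
      rewrite ge_min; apply/orP; right.
      rewrite mulrC -ler_pdivrMr//.
      by have := ratio0_nd (ltW yx); rewrite {1}/ratio0 x0.
  rewrite ge0_integralD//; last 3 first.
  - by move=> y _; rewrite lee_fin ltW.
  - move=> y _; rewrite mule_ge0// ?lee_fin ?(ltW mx0)//.
    by case: ifP => //; rewrite lee_fin ratio0_ge0.
  - by mfun; exact: measurable_ratio0.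
  rewrite integral_cst//= -[X in (c%:E * X)%E]/(F [set: R]) probability_setT mule1.
  rewrite leeD2l// ge0_integralZl//; last 3 first.
  - by mfun; exact: measurable_ratio0.
  - by move=> y _; case: ifP => //; rewrite lee_fin ratio0_ge0.
  - by rewrite lee_fin ltW.
  by rewrite lee_wpmul2l ?lee_fin ?(ltW mx0)// hc.
rewrite -EFinM -EFinD lee_fin => /le_trans; apply.
have := hx1 _ xx; rewrite ler_pdivrMr// => xc.
by nra.
Qed.

End truncated_means_infinite.

(** * A mixture of dilations of the increment law *)

Section dilation_mixture.
Variables (R : realType) (F : probability R R).

Definition dilation (k : nat) (y : R) : R := 2 ^+ k * y.

Lemma measurable_dilation k : measurable_fun [set: R] (dilation k).
Proof. by rewrite /dilation; mfun. Qed.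

HB.instance Definition _ k :=
  isMeasurableFun.Build _ _ _ _ (dilation k) (measurable_dilation k).

Definition dilation_weight (k : nat) : {nonneg R} := ((4 : R)^-1 ^+ k)%:nng.

(** The sum over k of 4^-k times the law of 2^k xi. The weights decrease fast
    enough for a to remain integrable, and slowly enough for the tail at x /
    4 to be at most 16 times the tail at x. *)
Definition dilation_mixture : set R -> \bar R :=
  mseries (fun k => mscale (dilation_weight k) (distribution F (dilation k))) 0.

HB.instance Definition _ := Measure.on dilation_mixture.

Lemma dilation_mixture_itv (x : R) : dilation_mixture (ray x) =
  (\sum_(k <oo) ((4 : R)^-1 ^+ k)%:E * F (ray (x / 2 ^+ k)))%E.
Proof.
rewrite /dilation_mixture /mseries; apply: eq_eseriesr => k _.
rewrite /mscale /= /distribution /pushforward; congr (_ * F _)%E.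
apply/seteqP; split => y /=; rewrite /dilation !in_itv/= !andbT.
  by rewrite ltr_pdivrMr ?exprn_gt0// mulrC.
by rewrite ltr_pdivrMr ?exprn_gt0// mulrC.
Qed.

Lemma geometric_half_sum (c : R) : 0 <= c ->
  (\sum_(k <oo) ((2 : R)^-1 ^+ k)%:E * c%:E <= (2 * c)%:E)%E.
Proof.
move=> c0; have := @cvg_geometric_eseries_half R (2 * c) 0.
rewrite expr0 divr1 => /cvg_lim <- //.
rewrite (_ : eseries _ = fun n =>
  \sum_(0 <= k < n) ((2 : R)^-1 ^+ k)%:E * c%:E)%E//.
apply/funext => n; rewrite /eseries /=; apply: eq_bigr => k _.
rewrite -EFinM addn1 natrX exprS invfM; congr (_%:E).
by rewrite exprVn; field; rewrite expf_neq0.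
Qed.

Lemma dilation_mixture_finite : fin_num_fun dilation_mixture.
Proof.
apply: lty_fin_num_fun.
apply: (@le_lt_trans _ _ (2 * 1)%:E); last by rewrite ltry.
apply: le_trans (geometric_half_sum ler01).
rewrite /dilation_mixture /mseries; apply: lee_nneseries => // k _.
have h : distribution F (dilation k) [set: R] = 1%E by exact:
  (@probability_setT _ _ _ (distribution F (dilation k))).
rewrite /mscale [X in (_ * X <= _)%E]h mule1.
rewrite mule1 lee_fin /=.
by rewrite lerXn2r ?nnegrE ?invr_ge0// lef_pV2 ?posrE// ler_nat.
Qed.

HB.instance Definition _ :=
  Measure_isFinite.Build _ _ _ dilation_mixture dilation_mixture_finite.

Lemma dilation_mixture_term (x : R) (k : nat) :
  (((4 : R)^-1 ^+ k)%:E * F (ray (x / 2 ^+ k)) <=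
   dilation_mixture (ray x))%E.
Proof.
rewrite dilation_mixture_itv.
apply: le_trans (@nneseries_lim_ge _ _ xpredT _ k.+1 _) => [|n _ _]; last first.
  by rewrite mule_ge0// lee_fin exprn_ge0.
by rewrite big_nat_recr//= leeDr// sume_ge0// => n _;
  rewrite mule_ge0// lee_fin exprn_ge0.
Qed.

(** The tail at x / 4 is the series of the tail at x, shifted by two terms and
    multiplied by 4 ^ 2. *)
Lemma dilation_mixture_doubling (x : R) :
  (dilation_mixture (ray (x / 4)) <=
   16%:E * dilation_mixture (ray x))%E.
Proof.
rewrite !dilation_mixture_itv -nneseriesZl//; last first.
  by move=> k _; rewrite mule_ge0// lee_fin exprn_ge0.
have g0 n : (0 <= 16%:E * ((4 : R)^-1 ^+ n)%:E * F (ray (x / 2 ^+ n)))%E.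
  by rewrite !mule_ge0// lee_fin ?exprn_ge0.
under [X in (_ <= X)%E]eq_eseriesr do rewrite muleA.
rewrite [X in (_ <= X)%E](nneseries_split _ 2)//= add0n.
rewrite [X in (_ <= _ + X)%E](_ : _ =
  \sum_(k <oo) ((4 : R)^-1 ^+ k)%:E * F (ray (x / 4 / 2 ^+ k)))%E.
  by rewrite leeDr// sume_ge0.
rewrite -nneseries_addn//; apply: eq_eseriesr => k _.
rewrite -EFinM; congr (_%:E * F _)%E.
  by rewrite addn2 !exprS; field.
by rewrite addn2 !exprS (_ : x / (2 * (2 * 2 ^+ k)) = x / 4 / 2 ^+ k)//; field;
  rewrite expf_neq0.
Qed.

Hypothesis infinite_mean : ('E_F[@neg_part R] = +oo)%E.
Hypothesis ratio_integrable :
  (\int[F]_(x in `]0%R, +oo[) (x / neg_tmean F x)%:E < +oo)%E.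

Lemma ratio0_integrable_dilation :
  (\int[dilation_mixture]_x (ratio0 F x)%:E < +oo)%E.
Proof.
have mr : measurable_fun [set: R] (EFin \o ratio0 F).
  by mfun; exact: measurable_ratio0.
have r0 x : (0 <= (ratio0 F x)%:E)%E by rewrite lee_fin ratio0_ge0.
rewrite /dilation_mixture ge0_integral_measure_series//.
have If : (\int[F]_x (ratio0 F x)%:E)%E \is a fin_num.
  rewrite ge0_fin_numE ?ratio0_integrable//; exact: integral_ge0.
set c := fine (\int[F]_x (ratio0 F x)%:E)%E.
have c0 : 0 <= c by apply/fine_ge0/integral_ge0.
apply: (@le_lt_trans _ _ (2 * c)%:E); last by rewrite ltry.
apply: le_trans (geometric_half_sum c0).
apply: lee_nneseries => [k _ _|k _]; first exact: integral_ge0.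
rewrite ge0_integral_mscale//= ge0_integral_distribution//.
apply: (@le_trans _ _ (((4 : R)^-1 ^+ k)%:E * \int[F]_x ((2 ^+ k)%:E *
  (ratio0 F x)%:E))%E).
  rewrite lee_wpmul2l// ?lee_fin ?exprn_ge0//; apply: ge0_le_integral => //.
  - by move=> x _ /=; rewrite lee_fin ratio0_ge0.
  - exact: (measurableT_comp mr (measurable_dilation k)).
  - by mfun; exact: measurable_ratio0.
  - by move=> x _ /=; rewrite lee_fin ratio0M// exprn_ege1// ler1n.
rewrite ge0_integralZl_EFin ?exprn_ge0// -(fineK If) -/c.
rewrite muleA -EFinM (_ : 4^-1 ^+ k * 2 ^+ k = 2^-1 ^+ k)//.
by rewrite -exprMn; congr (_ ^+ _); field.
Qed.

End dilation_mixture.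

(** * The tail of the supremum as a smallest excessive function *)

Lemma integral_ray (R : realType) (mu : {measure set R -> \bar R}) (x : R) :
  (\int[mu]_y (if (x < y)%R then 1 else 0) = mu (ray x))%E.
Proof.
rewrite -[in RHS](setIT (ray x)) -integral_indic//; apply: eq_integral => y _.
rewrite indicE; case: ifPn => xy; first by rewrite mem_set//= in_itv/= xy.
by rewrite memNset//= in_itv/= andbT; exact/negP.
Qed.

Lemma cst_integral (R : realType) (F : probability R R) (c : R) :
  (\int[F]_y c%:E = c%:E)%E.
Proof.
by rewrite integral_cst//= -[X in (_ * X)%E]/(F [set: R]) probability_setT mule1.
Qed.

(** The number v x stands for the probability that the walk started at 0 passes
    the level x, so that v (x - z) is that of passing x from the position z.
    The threshold c in sup_tail_minimal allows comparison with a function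
    that is excessive only as long as the walk is at distance at least c
    from the level. *)
Record sup_tail (R : realType) (F : probability R R)
  (v : R -> R) : Prop := SupTail {
  sup_tail01 : forall x, 0 <= v x <= 1;
  sup_tail_lt0 : forall x, x < 0 -> v x = 1;
  sup_tail_ni : {homo v : x y /~ x <= y};
  sup_tail_excessive : forall x, 0 <= x ->
    (\int[F]_y (v (x - y))%:E <= (v x)%:E)%E;
  sup_tail_minimal : forall (c : R) (w : R -> \bar R), 0 <= c ->
    measurable_fun [set: R] w -> (forall x, 0 <= w x)%E ->
    (forall x, x < c -> ((v x)%:E <= w x)%E) ->
    (forall x, c <= x -> (\int[F]_y w (x - y)%R <= w x)%E) ->
    forall x, ((v x)%:E <= w x)%E }.

Section truncated_reciprocal.
Variables (R : realType) (F : probability R R).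
Local Notation m := (neg_tmean F).
Hypothesis infinite_mean : ('E_F[@neg_part R] = +oo)%E.

(** Cut off at 0, where m vanishes. *)
Definition inv_tmean (s : R) : R := if 0 < s then (m s)^-1 else 0.

Lemma inv_tmean_ge0 s : 0 <= inv_tmean s.
Proof. by rewrite /inv_tmean; case: ifPn => // /ltW s0;
  rewrite invr_ge0 neg_tmean_ge0. Qed.

Lemma ratio0E s : ratio0 F s = s * inv_tmean s.
Proof. by rewrite /ratio0 /inv_tmean; case: ifP => //; rewrite mulr0. Qed.

Lemma measurable_inv_tmean : measurable_fun [set: R] inv_tmean.
Proof.
rewrite (_ : inv_tmean = fun s => ratio0 F s * s `^ (-1)).
  by mfun; exact: measurable_ratio0.
apply/funext => s; rewrite /inv_tmean /ratio0; case: ifPn => s0;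
  last by rewrite mul0r.
by rewrite powR_inv1 ?(ltW s0)// mulrAC divff ?mul1r// gt_eqF.
Qed.

End truncated_reciprocal.

(** * The supremum is finite *)

Section barrier_function.
Variables (R : realType) (F : probability R R).
Local Notation m := (neg_tmean F).
Local Notation E := (dilation_mixture F).
Hypothesis infinite_mean : ('E_F[@neg_part R] = +oo)%E.
Hypothesis ratio_integrable :
  (\int[F]_(x in `]0%R, +oo[) (x / neg_tmean F x)%:E < +oo)%E.
Hypothesis F_unbounded : forall x, (0 < F (ray x))%E.

(** As a function of x, (2 s - x)^+ / m(s) loses at least min(xi^-, s) / m(s)
    under a negative step from x <= s, hence at least 1 on average. *)
Definition barrier_kernel (x s : R) : R :=
  Num.max (2 * s - Num.max x 0) 0 * inv_tmean F s.

Definition barrier (x : R) : \bar R := (\int[E]_s (barrier_kernel x s)%:E)%E.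

Lemma barrier_kernel_ge0 x s : 0 <= barrier_kernel x s.
Proof. by rewrite mulr_ge0 ?inv_tmean_ge0// le_max lexx orbT. Qed.

Lemma measurable_barrier_kernel2 :
  measurable_fun [set: R * R] (fun z => barrier_kernel z.1 z.2).
Proof.
have mi := measurable_inv_tmean infinite_mean.
by rewrite /barrier_kernel; mfun.
Qed.

Lemma measurable_barrier_kernel x : measurable_fun [set: R] (barrier_kernel x).
Proof. exact: (measurableT_comp measurable_barrier_kernel2
  (pair1_measurable x)). Qed.

Lemma barrier_kernel_ni x y s : x <= y -> barrier_kernel y s <= barrier_kernel x s.
Proof.
move=> xy; rewrite ler_wpM2r ?inv_tmean_ge0// ge_max !le_max lexx !orbT andbT.
by apply/orP; left; rewrite lerB// ge_max !le_max xy lexx !orbT.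
Qed.

Lemma barrier_ge0 x : (0 <= barrier x)%E.
Proof. by apply: integral_ge0 => s _; rewrite lee_fin barrier_kernel_ge0. Qed.

Lemma barrier_ni x y : x <= y -> (barrier y <= barrier x)%E.
Proof.
move=> xy; apply: ge0_le_integral => //.
- by move=> s _; rewrite lee_fin barrier_kernel_ge0.
- by mfun; exact: measurable_barrier_kernel.
- by mfun; exact: measurable_barrier_kernel.
- by move=> s _; rewrite lee_fin barrier_kernel_ni.
Qed.

(** The kernel vanishes for s <= x / 2; this makes the barrier tend to 0. *)
Lemma barrier_kernel_le x s : 0 <= x ->
  barrier_kernel x s <= 2 * (if x / 2 < s then ratio0 F s else 0).
Proof.
move=> x0; rewrite /barrier_kernel (max_l x0); case: ifPn => xs.
  have s0 : 0 < s by rewrite (le_lt_trans _ xs)// divr_ge0.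
  rewrite ratio0E mulrA ler_wpM2r ?inv_tmean_ge0// ge_max.
  by rewrite lerBlDr lerDl x0 mulr_ge0// ltW.
by rewrite mulr0 max_r ?mul0r//; move: xs; rewrite -leNgt; lra.
Qed.

Lemma barrier_small (e : R) : 0 < e ->
  exists2 x0 : R, 0 < x0 & forall x, x0 <= x -> (barrier x <= e%:E)%E.
Proof.
move=> e0; have e20 : 0 < e / 2 by rewrite divr_gt0.
have [||||c c0 hc] := @tail_integral_small _ _ _ E id
  (EFin \o ratio0 F) _ _ _ _ _ e20 => //.
- by mfun; exact: measurable_ratio0.
- by move=> y; rewrite lee_fin ratio0_ge0.
- exact: ratio0_integrable_dilation.
exists (2 * c) => [|x xc]; first by rewrite mulr_gt0.
have x0 : 0 <= x by apply: le_trans xc; rewrite mulr_ge0// ltW.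
apply: (@le_trans _ _ (\int[E]_s (2%:E * (if (x / 2 < s)%R then
  (ratio0 F s)%:E else 0)))%E).
  apply: ge0_le_integral => //.
  - by move=> s _; rewrite lee_fin barrier_kernel_ge0.
  - by mfun; exact: measurable_barrier_kernel.
  - by mfun; exact: measurable_ratio0.
  - move=> s _; apply: (@le_trans _ _ (2 *
    (if x / 2 < s then ratio0 F s else 0))%:E).
      by rewrite lee_fin barrier_kernel_le.
    by rewrite EFinM; case: ifP.
rewrite ge0_integralZl_EFin//; last 2 first.
- by move=> s _; case: ifP => //; rewrite lee_fin ratio0_ge0.
- by mfun; exact: measurable_ratio0.
have /(_ (x / 2)) := hc; rewrite ler_pdivlMr// mulrC => /(_ xc) h.
apply: (@le_trans _ _ (2%:E * (e / 2)%:E)%E); first by rewrite lee_wpmul2l.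
by rewrite -EFinM lee_fin mulrC divfK.
Qed.

Lemma barrier_fin x : barrier x \is a fin_num.
Proof.
rewrite ge0_fin_numE ?barrier_ge0//.
apply: (@le_lt_trans _ _ (\int[E]_s (2%:E * (ratio0 F s)%:E))%E).
  apply: ge0_le_integral => //.
  - by move=> s _; rewrite lee_fin barrier_kernel_ge0.
  - by mfun; exact: measurable_barrier_kernel.
  - by mfun; exact: measurable_ratio0.
  - move=> s _; apply: (@le_trans _ _ (barrier_kernel 0 s)%:E).
      rewrite lee_fin (_ : barrier_kernel 0 s = barrier_kernel (Num.min x 0) s).
        by apply: barrier_kernel_ni; rewrite ge_min lexx.
      by rewrite /barrier_kernel maxxx (max_r
        (_ : Num.min x 0 <= 0))// ge_min lexx orbT.
    rewrite -EFinM lee_fin (le_trans (barrier_kernel_le _ (lexx 0)))// ler_pM2l//.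
    by case: ifP => // _; exact: ratio0_ge0.
rewrite ge0_integralZl_EFin//; last 2 first.
- by move=> s _; rewrite lee_fin ratio0_ge0.
- by mfun; exact: measurable_ratio0.
by rewrite lte_mul_pinfty// ratio0_integrable_dilation.
Qed.

Lemma barrier_gt0 x : 0 < x -> (0 < barrier x)%E.
Proof.
move=> x0; apply: (@lt_le_trans _ _ ((ratio0 F x)%:E * E (ray x))%E).
  rewrite mule_gt0// ?lte_fin ?ratio0_gt0//.
  apply: (lt_le_trans (F_unbounded x)).
  by have := dilation_mixture_term F x 0; rewrite expr0 mul1e expr0 divr1.
rewrite -integral_ray -ge0_integralZl_EFin//; last 3 first.
- by move=> y _; case: ifP.
- by mfun.
- by rewrite ratio0_ge0.
apply: ge0_le_integral => //.
- by move=> y _; rewrite mule_ge0// ?lee_fin ?ratio0_ge0//; case: ifP.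
- by mfun.
- by mfun; exact: measurable_barrier_kernel.
- move=> s _; case: ifPn => xs; last by rewrite mule0 lee_fin barrier_kernel_ge0.
  rewrite mule1 lee_fin (le_trans (ratio0_nd infinite_mean (ltW xs)))// ratio0E.
  rewrite /barrier_kernel ler_wpM2r ?inv_tmean_ge0// le_max max_l ?(ltW x0)//.
  by apply/orP; left; lra.
Qed.

End barrier_function.

Section transience.
Variables (R : realType) (F : probability R R) (v : R -> R).
Local Notation m := (neg_tmean F).
Local Notation E := (dilation_mixture F).
Hypothesis infinite_mean : ('E_F[@neg_part R] = +oo)%E.
Hypothesis ratio_integrable :
  (\int[F]_(x in `]0%R, +oo[) (x / neg_tmean F x)%:E < +oo)%E.
Hypothesis F_unbounded : forall x, (0 < F (ray x))%E.
Hypothesis v_sup_tail : sup_tail F v.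

(** What the kernel loses when the increment is y <= 0. *)
Definition barrier_loss (x y s : R) : R :=
  Num.min (neg_part y) (Num.max (2 * s - x) 0) * inv_tmean F s.

Lemma barrier_loss_ge0 x y s : 0 <= barrier_loss x y s.
Proof.
by rewrite mulr_ge0 ?inv_tmean_ge0// le_min neg_part_ge0 le_max lexx orbT.
Qed.

Lemma measurable_barrier_loss x :
  measurable_fun [set: R * R] (fun z => barrier_loss x z.1 z.2).
Proof.
have mi := measurable_inv_tmean infinite_mean.
by rewrite /barrier_loss; mfun.
Qed.

Lemma barrier_loss_down x y : 0 <= x -> y <= 0 ->
  (barrier F (x - y) + \int[E]_s (barrier_loss x y s)%:E = barrier F x)%E.
Proof.
move=> x0 y0; have mk := fun x => measurable_barrier_kernel infinite_mean x.
have ml : measurable_fun [set: R] (barrier_loss x y).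
  exact: (measurableT_comp (measurable_barrier_loss x) (pair1_measurable y)).
rewrite /barrier -ge0_integralD//.
- apply: eq_integral => s _; rewrite -EFinD; congr (_%:E).
  rewrite /barrier_kernel /barrier_loss -mulrDl; congr (_ * _).
  rewrite (max_l x0) (max_l (_ : 0 <= x - y)); last by lra.
  rewrite /neg_part (max_l (_ : 0 <= - y)); last by lra.
  by rewrite /Num.min /Num.max; repeat case: ifP; lra.
- by move=> s _; rewrite lee_fin barrier_kernel_ge0.
- by have := mk (x - y) => ?; mfun.
- by move=> s _; rewrite lee_fin barrier_loss_ge0.
- by mfun.
Qed.

(** The slope of the kernel in x is at most 1 / m(s), and only the s > x / 4
    contribute on the segment from x - y to x. *)
Lemma barrier_small_jump x y : 0 < x -> 0 <= y <= x / 2 ->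
  (barrier F (x - y) <=
   barrier F x + (y / m (x / 4))%:E * E (ray (x / 4)))%E.
Proof.
move=> x0 /andP[y0 yx]; have x40 : 0 < x / 4 by rewrite divr_gt0.
have m0 := neg_tmean_gt0 infinite_mean x40.
have mk := fun x => measurable_barrier_kernel infinite_mean x.
have my := mk (x - y); have mx := mk x.
rewrite -integral_ray -ge0_integralZl_EFin//; last 3 first.
- by move=> s _; case: ifP.
- by mfun.
- by rewrite divr_ge0// ltW.
rewrite /barrier -ge0_integralD//; last 4 first.
- by move=> s _; rewrite lee_fin barrier_kernel_ge0.
- by mfun.
- by move=> s _; rewrite mule_ge0// ?lee_fin ?divr_ge0// ?(ltW m0)//; case: ifP.
- by mfun.
apply: ge0_le_integral => //.
- by move=> s _; rewrite lee_fin barrier_kernel_ge0.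
- by mfun.
- by mfun.
move=> s _; rewrite /barrier_kernel (max_l (_ : 0 <= x - y)); last by lra.
rewrite (max_l (ltW x0)); case: ifPn => xs; last first.
  rewrite mule0 adde0 lee_fin max_r ?mul0r; last by move: xs; rewrite -leNgt; lra.
  by rewrite mulr_ge0 ?inv_tmean_ge0// le_max lexx orbT.
rewrite mule1 lee_fin.
have : inv_tmean F s <= (m (x / 4))^-1.
  have s0 := lt_trans x40 xs.
  rewrite /inv_tmean s0 lef_pV2 ?posrE// ?neg_tmean_gt0// neg_tmean_le//;
    exact: ltW.
have := inv_tmean_ge0 F s.
set i := inv_tmean F s => i0 im.
apply: (@le_trans _ _ (Num.max (2 * s - x) 0 * i + y * i)); last first.
  by rewrite lerD2l ler_wpM2l.
rewrite -mulrDl ler_wpM2r//.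
by rewrite /Num.max; repeat case: ifP; lra.
Qed.

Definition capped_barrier (C x : R) : R := Num.min 1 (C * fine (barrier F x)).

Lemma capped_barrier01 C x : 0 <= C -> 0 <= capped_barrier C x <= 1.
Proof.
move=> C0; rewrite le_min ler01 ge_min lexx mulr_ge0//=.
by rewrite fine_ge0// barrier_ge0.
Qed.

Lemma measurable_capped_barrier C : measurable_fun [set: R] (capped_barrier C).
Proof.
have h : measurable_fun [set: R] (fun x => fine (barrier F x)).
  apply: nonincreasing_measurable => // x y xy.
  by rewrite fine_le ?barrier_fin ?barrier_ni.
by rewrite /capped_barrier; mfun.
Qed.

(** The average loss by negative jumps is at least C times the tail of E at x.
    Positive jumps below x / 2 gain at most a small multiple of this, since
    their truncated mean is small compared with m and the tail of E at x / 4
    is comparable with the one at x; a jump above x / 2 gains at most 1,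
    which C outweighs. *)
Lemma capped_barrier_excessive (C x : R) : 8 <= C -> 0 < x ->
  pos_tmean F (x / 2) <= 1 / 64 * m (x / 2) ->
  (\int[F]_y (capped_barrier C (x - y))%:E <= (C * fine (barrier F x))%:E)%E.
Proof.
move=> C8 x0 px; have C0 : 0 <= C by lra.
have x40 : 0 < x / 4 by rewrite divr_gt0.
have x20 : 0 < x / 2 by rewrite divr_gt0.
have m0 := neg_tmean_gt0 infinite_mean x40.
have bE z : (fine (barrier F z))%:E = barrier F z by rewrite fineK// barrier_fin.
pose e z := fine (E (ray z)).
have eE z : (e z)%:E = E (ray z).
  by rewrite fineK//; apply: fin_num_measure.
have e0 z : 0 <= e z by rewrite fine_ge0.
pose c1 := e (x / 4) / m (x / 4).
have c10 : 0 <= c1 by rewrite divr_ge0// ltW.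
have mc := measurable_capped_barrier C.
have ml := measurable_barrier_loss x.
pose I := (\int[F]_y (capped_barrier C (x - y))%:E)%E.
pose L y := (\int[E]_s (barrier_loss x y s)%:E)%E.
have L0 y : (0 <= L y)%E.
  by apply: integral_ge0 => s _; rewrite lee_fin barrier_loss_ge0.
have mL : measurable_fun [set: R] L.
  apply: (measurable_fun_fubini_tonelli_F (m2 := E)
    (fun z : R * R => (barrier_loss x z.1 z.2)%:E)); first by mfun.
  by move=> z; rewrite lee_fin barrier_loss_ge0.
have loss : (E (ray x) <= \int[F]_y L y)%E.
  rewrite /L (fubini_tonelli (m1 := F) (m2 := E)
    (fun z : R * R => (barrier_loss x z.1 z.2)%:E))/=; last 2 first.
  - by mfun.
  - by move=> z; rewrite lee_fin barrier_loss_ge0.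
  rewrite -integral_ray; apply: ge0_le_integral => //.
  - by move=> s _; case: ifP.
  - by mfun.
  - apply: (measurable_fun_fubini_tonelli_G (m1 := F)
      (fun z : R * R => (barrier_loss x z.1 z.2)%:E)); first by mfun.
    by move=> z; rewrite lee_fin barrier_loss_ge0.
  move=> s _; case: ifPn => xs; last first.
    by apply: integral_ge0 => y _; rewrite lee_fin barrier_loss_ge0.
  have s0 := lt_trans x0 xs.
  rewrite /barrier_loss (max_l (_ : 0 <= 2 * s - x)); last by lra.
  under eq_integral do rewrite EFinM.
  rewrite ge0_integralZr//; last 3 first.
  - by mfun.
  - by move=> y _; rewrite lee_fin le_min neg_part_ge0; lra.
  - by rewrite lee_fin inv_tmean_ge0.
  rewrite -neg_tmeanE; last by lra.
  rewrite -EFinM lee_fin /inv_tmean s0 ler_pdivlMr ?mul1r ?neg_tmean_gt0//.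
  by rewrite neg_tmean_le//; lra.
have key : (I + C%:E * \int[F]_y L y <=
    (C * fine (barrier F x))%:E + (C * c1)%:E * (pos_tmean F (x / 2))%:E
    + F (ray (x / 2)))%E.
  rewrite -ge0_integralZl_EFin// -ge0_integralD//; last 4 first.
  - by move=> y _; rewrite lee_fin; case/andP: (capped_barrier01 (x - y) C0).
  - by mfun.
  - by move=> y _; rewrite mule_ge0.
  - by mfun.
  pose B1 (y : R) : \bar R := (C * fine (barrier F x))%:E.
  pose B2 (y : R) := ((C * c1)%:E * (Num.min (Num.max y 0) (x / 2))%:E)%E.
  pose B3 (y : R) : \bar R := if x / 2 < y then 1%E else 0%E.
  have B10 y : (0 <= B1 y)%E by rewrite lee_fin mulr_ge0// fine_ge0// barrier_ge0.
  have B20 y : (0 <= B2 y)%E.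
    by apply: mule_ge0; rewrite lee_fin;
      [exact: mulr_ge0|rewrite le_min le_max lexx orbT ltW].
  have B30 y : (0 <= B3 y)%E by rewrite /B3; case: ifP.
  have mB1 : measurable_fun [set: R] B1 by exact: measurable_cst.
  have mB2 : measurable_fun [set: R] B2 by rewrite /B2; mfun.
  have mB3 : measurable_fun [set: R] B3 by rewrite /B3; mfun.
  rewrite [leRHS](_ : _ = \int[F]_y (B1 y + B2 y + B3 y))%E; last first.
    rewrite !ge0_integralD//; last 2 first.
    - by move=> y _; exact: adde_ge0.
    - by mfun.
    rewrite cst_integral /B3 integral_ray pos_tmeanE ?(ltW x20)//.
    rewrite ge0_integralZl_EFin//; first last.
    - by rewrite mulr_ge0.
    - by mfun.
    - by move=> y _; rewrite lee_fin le_min le_max lexx orbT ltW.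
  apply: ge0_le_integral => //.
  - move=> y _; rewrite adde_ge0 ?mule_ge0// lee_fin.
    by case/andP: (capped_barrier01 (x - y) C0).
  - by mfun.
  - by mfun.
  rewrite /B1 /B2 /B3; move=> y _; have [y0|y0] := leP y 0.
    rewrite (min_l (ltW x20)) mule0 adde0 ifF; last by apply/negbTE;
      rewrite -leNgt; lra.
    rewrite adde0 EFinM bE -(barrier_loss_down (ltW x0) y0).
    rewrite [leRHS]ge0_muleDr ?barrier_ge0//; last exact: L0.
    by apply: leeD => //; rewrite -bE -EFinM lee_fin /capped_barrier ge_min
      lexx orbT.
  have -> : L y = 0%E.
    rewrite /L; apply: integral0_eq => s _; rewrite /barrier_loss /neg_part.
    rewrite (max_r (_ : - y <= 0)) ?oppr_le0 ?(ltW y0)// min_l ?mul0r//.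
    by rewrite le_max lexx orbT.
  rewrite mule0 adde0; case: ifPn => xy.
    rewrite -EFinM -!EFinD lee_fin ler_wpDl//.
      apply: addr_ge0; first by rewrite mulr_ge0// fine_ge0// barrier_ge0.
      by apply: mulr_ge0; [exact: mulr_ge0|rewrite le_min (ltW y0) ltW].
    by case/andP: (capped_barrier01 (x - y) C0).
  rewrite -leNgt in xy; rewrite adde0 (min_l xy).
  rewrite -EFinM -!EFinD lee_fin /capped_barrier ge_min; apply/orP; right.
  have h : fine (barrier F (x - y)) <= fine (barrier F x) + y / m (x / 4) * e
    (x / 4).
    rewrite -lee_fin EFinD EFinM !bE eE; apply: barrier_small_jump => //.
    by apply/andP; split=> //; exact: ltW.
  apply: (le_trans (ler_wpM2l C0 h)); rewrite mulrDr lerD2l /c1.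
  by rewrite le_eqVlt; apply/orP; left; apply/eqP; field; rewrite gt_eqF.
have Ifin : I \is a fin_num.
  by apply: (proj1 (@fin_num_integral_le _ F (fun y =>
    capped_barrier C (x - y)) 1 _ _)); [mfun|move=> y; exact: capped_barrier01].
have key2 : (I + C%:E * E (ray x) <=
    (C * fine (barrier F x))%:E + (C * c1)%:E * (pos_tmean F (x / 2))%:E
    + F (ray (x / 2)))%E.
  by apply: (le_trans _ key); rewrite leeD2l// lee_wpmul2l// lee_fin.
have h1 := dilation_mixture_term F x 1; rewrite !expr1 -eE in h1.
have F2 : F (ray (x / 2)) \is a fin_num by exact: fin_num_measure.
have h2 := dilation_mixture_doubling F x; rewrite -!eE -EFinM lee_fin in h2.
rewrite -(fineK F2) -EFinM lee_fin in h1.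
rewrite -/I; move: key2;
  rewrite -(fineK Ifin) -(fineK F2) -eE -!EFinM -!EFinD !lee_fin.
move: h1; set f2 := fine (F _); set b := fine (barrier F x); set i := fine I.
move=> h1.
have m2 : m (x / 2) <= 2 * m (x / 4).
  have := neg_tmean_div_le F x40 (_ : x / 4 <= x / 2).
  by rewrite (_ : x / 2 / (x / 4) = 2); [apply; lra|field; rewrite gt_eqF].
have : C * c1 * pos_tmean F (x / 2) <= C * (e x / 2).
  rewrite -mulrA ler_wpM2l// /c1 mulrAC ler_pdivrMr//.
  have p0 := pos_tmean_ge0 F (ltW x20).
  by have := e0 x; have := e0 (x / 4); nra.
have := e0 x; nra.
Qed.

(** M is finite almost surely: the barrier, multiplied by a constant that makes
    it at least 1 where the previous estimate may fail, is an excessive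
    majorant of v that tends to 0. *)
Lemma sup_tail_small (e : R) : 0 < e ->
  exists2 x0 : R, 0 < x0 & forall x, x0 <= x -> v x <= e.
Proof.
move=> e0.
have e64 : (0 : R) < 1 / 64 by rewrite divr_gt0.
have [x1 x10 hx1] := pos_tmean_small infinite_mean ratio_integrable e64.
(* The estimate needs x / 2 >= x1. *)
pose x0 := 2 * x1; have x00 : 0 < x0 by rewrite mulr_gt0.
have b0 : 0 < fine (barrier F x0).
  by rewrite fine_gt0// barrier_gt0// -ge0_fin_numE ?barrier_ge0// barrier_fin.
pose C := Num.max 8 (fine (barrier F x0))^-1.
have C8 : 8 <= C by rewrite le_max lexx.
have C0 : 0 < C by lra.
have bmono x y : x <= y -> fine (barrier F y) <= fine (barrier F x).
  by move=> xy; rewrite fine_le ?barrier_fin ?barrier_ni.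
have wlow x : x <= x0 -> capped_barrier C x = 1.
  move=> xx0; rewrite /capped_barrier min_l//.
  apply: (@le_trans _ _ ((fine (barrier F x0))^-1 * fine (barrier F x0))).
    by rewrite mulVf// gt_eqF.
  apply: ler_pM; rewrite ?invr_ge0 ?(ltW b0)// ?bmono//.
  by rewrite le_max lexx orbT.
have vle : forall x, v x <= capped_barrier C x.
  move=> x.
  rewrite -lee_fin.
  apply: (sup_tail_minimal v_sup_tail (c := 0)
    (w := EFin \o capped_barrier C)) => //.
  - by have := measurable_capped_barrier C => ?; mfun.
  - by move=> y /=; rewrite lee_fin; case/andP: (capped_barrier01 y (ltW C0)).
  - move=> y y0 /=; rewrite wlow ?lee_fin; last by rewrite ltW// (lt_trans y0).
    by case/andP: (sup_tail01 v_sup_tail y).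
  move=> y y0 /=; have mc := measurable_capped_barrier C.
  have le1 : (\int[F]_z (capped_barrier C (y - z))%:E <= 1%:E)%E.
    apply: (proj2 (@fin_num_integral_le _ F (fun z =>
      capped_barrier C (y - z)) 1 _ _)); first by mfun.
    by move=> z; apply: capped_barrier01; exact: ltW.
  have [yx0|yx0] := leP y x0; first by rewrite wlow.
  have yp := lt_trans x00 yx0.
  have := capped_barrier_excessive C8 yp; have := hx1 (y / 2).
  rewrite ler_pdivlMr// mulrC (ltW yx0) => /(_ isT) h /(_ h) h'.
  by rewrite [X in (_ <= X%:E)%E]/capped_barrier /Num.min; case: ifP.
have eC : 0 < e / C by rewrite divr_gt0.
have [x2 x20 hx2] := barrier_small infinite_mean ratio_integrable eC.
exists x2 => // x /hx2;
  rewrite -(fineK (barrier_fin infinite_mean ratio_integrable x)).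
rewrite lee_fin ler_pdivlMr// mulrC => h.
by rewrite (le_trans (vle x))// /capped_barrier ge_min h orbT.
Qed.

End transience.

(** * A Green function bound *)

Lemma affine_step_inside (R : realType) (T L z y : R) :
  0 < T -> z + y <= L -> - T < z -> - T < z + y ->
  (z + y + 2 * T) + Num.min (neg_part y) T <=
  (z + 2 * T) + Num.min (Num.max y 0) (T + L).
Proof.
move=> T0 zyL Tz Tzy.
have [y0|y0] := leP y 0.
  have : Num.min (neg_part y) T <= neg_part y by rewrite ge_min lexx.
  rewrite (min_l (_ : 0 <= T + L)); last by lra.
  by rewrite /neg_part max_l ?oppr_ge0//; lra.
rewrite (min_l (_ : y <= T + L)); last by lra.
by rewrite /neg_part (max_r
  (_ : - y <= 0)) ?min_l ?oppr_le0 ?(ltW T0) ?(ltW y0)//; lra.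
Qed.

Lemma affine_step_below (R : realType) (T L z y : R) :
  0 < T -> 0 <= T + L -> - T < z ->
  Num.min (neg_part y) T <= (z + 2 * T) + Num.min (Num.max y 0) (T + L).
Proof.
move=> T0 TL Tz.
have h1 : Num.min (neg_part y) T <= T by rewrite ge_min lexx orbT.
have h2 : 0 <= Num.min (Num.max y 0) (T + L) by rewrite le_min TL le_max lexx orbT.
by lra.
Qed.

Section green_bound.
Variables (R : realType) (F : probability R R) (v : R -> R).
Local Notation m := (neg_tmean F).
Local Notation p := (pos_tmean F).
Hypothesis infinite_mean : ('E_F[@neg_part R] = +oo)%E.
Hypothesis ratio_integrable :
  (\int[F]_(x in `]0%R, +oo[) (x / neg_tmean F x)%:E < +oo)%E.
Hypothesis v_sup_tail : sup_tail F v.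
Variables (K L : R).
Hypotheses (K0 : 0 <= K) (L0 : 0 <= L).

(** Affine above - T, with slope chosen so that the value at L is 1, and
    constant below. Below, T is t + K, and v K bounds the probability of
    coming back above - t from below - T. *)
Definition exit_profile (T u : R) : R :=
  (if - T < u then (1 - v K) * (u + 2 * T) / (2 * T + L) else 0) + v K.

(** For a suitable D, close to 2 a(t), a majorant of the expected number of
    visits to ]-t, L] of the walk started at z and killed above L. The
    factor v (- t - z) is the probability of ever being above - t. *)
Definition green (D t z : R) : R :=
  D * Num.min (exit_profile (t + K) z) (v (- t - z)).

Lemma sup_tail_ge0 x : 0 <= v x.
Proof. by case/andP: (sup_tail01 v_sup_tail x). Qed.

Lemma sup_tail_le1 x : v x <= 1.
Proof. by case/andP: (sup_tail01 v_sup_tail x). Qed.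

Lemma measurable_sup_tail : measurable_fun [set: R] v.
Proof.
by apply: nonincreasing_measurable => // x y xy; exact: (sup_tail_ni v_sup_tail).
Qed.

Lemma exit_profile_ge0 T u : 0 < T -> 0 <= exit_profile T u.
Proof.
move=> T0; rewrite /exit_profile addr_ge0 ?sup_tail_ge0//; case: ifPn => // Tu.
apply: divr_ge0; last by rewrite addr_ge0 ?mulr_ge0// ltW.
by rewrite mulr_ge0 ?subr_ge0 ?sup_tail_le1//; lra.
Qed.

Lemma exit_profile_le1 T u : 0 < T -> u <= L -> exit_profile T u <= 1.
Proof.
have lK := K0; have lL := L0.
move=> T0 uL; rewrite /exit_profile; case: ifPn => Tu;
  last by rewrite add0r sup_tail_le1.
rewrite -lerBrDr ler_pdivrMr; last by lra.
by rewrite ler_wpM2l ?subr_ge0 ?sup_tail_le1//; lra.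
Qed.

Lemma green_ge0 D t z : 0 <= D -> 0 < t -> 0 <= green D t z.
Proof.
move=> D0 t0; rewrite mulr_ge0// le_min sup_tail_ge0 exit_profile_ge0//.
by rewrite ltr_wpDr.
Qed.

Lemma green_le D t z : 0 <= D -> green D t z <= D.
Proof.
by move=> D0; rewrite ler_piMr// ge_min sup_tail_le1 orbT.
Qed.

Lemma measurable_green_pair (D T : R -> R) :
  measurable_fun [set: R] D -> measurable_fun [set: R] T ->
  (forall t, 0 < T t) ->
  measurable_fun [set: R * R] (fun z => green (D z.1) (T z.1) z.2).
Proof.
move=> mD mT T0; have mv := measurable_sup_tail.
rewrite (_ : (fun z => _) = fun z : R * R =>
    D z.1 * Num.min ((if - (T z.1 + K) < z.2 then
      (1 - v K) * (z.2 + 2 * (T z.1 + K)) * (2 * (T z.1 + K) + L) `^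
        (-1) else 0) + v K)
      (v (- T z.1 - z.2))); last first.
  apply/funext => z; rewrite /green /exit_profile powR_inv1//.
  by rewrite addr_ge0 ?mulr_ge0 ?addr_ge0 ?(ltW (T0 _)).
by mfun.
Qed.

Lemma measurable_green D t : 0 < t -> measurable_fun [set: R] (green D t).
Proof.
move=> t0.
have := @measurable_green_pair (cst D) (cst t) _ _ (fun=> t0).
move=> /(_ (measurable_cst _) (measurable_cst _)) h.
exact: (measurableT_comp h (pair1_measurable (0 : R))).
Qed.

(** Above -T, a negative step truncated at T decreases the affine part, which is
    at least T there, by its full size; a positive step without killing
    increases it by at most min(y, T + L). *)
Lemma green_step_inside D t z : 0 <= D -> 0 < t -> - (t + K) < z <= L ->
  1 <= (1 - v K) * D / (2 * (t + K) + L) * (m (t + K) - p (t + K + L)) ->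
  (\int[F]_y (if (z + y <= L)%R then (green D t (z + y))%:E else 0) + 1 <=
   (D * exit_profile (t + K) z)%:E)%E.
Proof.
have lK := K0; have lL := L0.
move=> D0 t0 /andP[Tz zL]; set T := t + K; set al := _ / (2 * T + L) => al1.
have TE : T = t + K by [].
have TL0 : 0 <= T + L by lra.
have T0 : 0 < T by rewrite ltr_wpDr.
have al0 : 0 <= al by rewrite divr_ge0 ?mulr_ge0 ?subr_ge0 ?sup_tail_le1//; lra.
have mg := measurable_green D t0.
have If : (\int[F]_y (if (z + y <= L)%R then (green D t (z + y))%:E else 0))%E
    \is a fin_num.
  rewrite (_ : (fun y => _) = fun y =>
      (if (z + y <= L) then green D t (z + y) else 0)%:E); last first.
    by apply/funext => y; case: ifP.
  apply: (proj1 (@fin_num_integral_le _ F _ D _ _)); first by mfun.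
  by move=> y; case: ifP => _; rewrite ?lexx// green_ge0// green_le.
have key : (\int[F]_y (if (z + y <= L)%R then (green D t (z + y))%:E else 0)
    + al%:E * (m T)%:E <= (D * exit_profile T z)%:E + al%:E * (p (T + L))%:E)%E.
  rewrite neg_tmeanE ?(ltW T0)// pos_tmeanE//.
  rewrite -[X in (_ <= X + _)%E](cst_integral F).
  rewrite -!ge0_integralZl_EFin//; last 4 first.
  - by move=> y _; rewrite lee_fin le_min le_max lexx orbT addr_ge0// ltW.
  - by mfun.
  - by move=> y _; rewrite lee_fin le_min neg_part_ge0 ltW.
  - by mfun.
  have g0 y : (0 <= (if (z + y <= L)%R then (green D t (z + y))%:E else 0%E))%E.
    by case: ifP => // _; rewrite lee_fin green_ge0.
  have h0 y : (0 <= al%:E * (Num.min (@neg_part R y) T)%:E)%E.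
    by rewrite mule_ge0// lee_fin le_min neg_part_ge0 ltW.
  have k0 : (0 <= (D * exit_profile T z)%:E)%E.
    by rewrite lee_fin mulr_ge0// exit_profile_ge0.
  have l0 y : (0 <= al%:E * (Num.min (Num.max y 0) (T + L))%:E)%E.
    by rewrite mule_ge0// lee_fin le_min le_max lexx orbT addr_ge0// ltW.
  rewrite -!ge0_integralD//; [|by mfun..].
  apply: ge0_le_integral => //.
  - by move=> y _; rewrite adde_ge0.
  - by mfun.
  - by mfun.
  move=> y _; have alE : (D * exit_profile T z) = al * (z + 2 * T) + D * v K.
    by rewrite /exit_profile Tz /al; field; rewrite gt_eqF//; lra.
  have vK := sup_tail_ge0 K; have DvK : 0 <= D * v K by rewrite mulr_ge0.
  rewrite alE -!EFinM; case: ifPn => zyL; last first.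
    rewrite -ltNge in zyL; rewrite add0e -EFinD lee_fin.
    rewrite /neg_part (max_r (_ : - y <= 0)); last by lra.
    rewrite (min_l (ltW T0)) mulr0; apply: addr_ge0.
      by apply: addr_ge0 => //; apply: mulr_ge0 => //; lra.
    by rewrite mulr_ge0// le_min le_max lexx orbT addr_ge0// ltW.
  rewrite -!EFinD lee_fin.
  apply: (@le_trans _ _ (D * exit_profile T (z + y) + al * Num.min (neg_part y) T)).
    by rewrite lerD2r ler_wpM2l// ge_min lexx.
  rewrite {1}/exit_profile; case: ifPn => Tzy.
    have -> : D * ((1 - v K) * (z + y + 2 * T) / (2 * T + L) + v K) =
        al * (z + y + 2 * T) + D * v K.
      by rewrite /al; field; rewrite gt_eqF//; lra.
    have : (z + y + 2 * T) + Num.min (neg_part y) T <=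
        (z + 2 * T) + Num.min (Num.max y 0) (T + L).
      exact: affine_step_inside.
    by move/(ler_wpM2l al0); rewrite !mulrDr; lra.
  have : Num.min (neg_part y) T <= (z + 2 * T) + Num.min (Num.max y 0) (T + L).
    exact: affine_step_below.
  by rewrite add0r; move/(ler_wpM2l al0); rewrite !mulrDr; lra.
move: key; rewrite -(fineK If) -!EFinM -!EFinD !lee_fin.
by move: al1; rewrite mulrBr; lra.
Qed.

(** Below -t only the probability of returning above -t counts, and it is
    excessive. *)
Lemma green_step_outside D t z : 0 <= D -> 0 < t -> z <= - t ->
  (\int[F]_y (if (z + y <= L)%R then (green D t (z + y))%:E else 0) <=
   (D * v (- t - z))%:E)%E.
Proof.
have lK := K0; have lL := L0.
move=> D0 t0 zt; have mg := measurable_green D t0; have mv := measurable_sup_tail.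
apply: (@le_trans _ _ (D%:E * \int[F]_y (v ((- t - z) - y))%:E)%E).
  rewrite -ge0_integralZl_EFin//; last 2 first.
  - by move=> y _; rewrite lee_fin sup_tail_ge0.
  - by mfun.
  apply: ge0_le_integral => //.
  - by move=> y _; case: ifP => // _; rewrite lee_fin green_ge0.
  - by mfun.
  - by mfun.
  move=> y _; rewrite -EFinM; case: ifP => _; rewrite lee_fin.
    by rewrite ler_wpM2l// ge_min (_ : - t -
      (z + y) = - t - z - y) ?lexx ?orbT//; ring.
  by rewrite mulr_ge0// sup_tail_ge0.
rewrite EFinM lee_wpmul2l// sup_tail_excessive//.
by lra.
Qed.

(** A minimum of excessive functions is excessive; inside ]-t, L] the minimum is
    the profile, whose loss is at least 1. *)
Lemma green_excessive D t z : 0 <= D -> 0 < t -> z <= L ->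
  1 <= (1 - v K) * D / (2 * (t + K) + L) * (m (t + K) - p (t + K + L)) ->
  (\int[F]_y (if (z + y <= L)%R then (green D t (z + y))%:E else 0)
    + (if (- t < z)%R then 1 else 0) <= (green D t z)%:E)%E.
Proof.
have lK := K0; have lL := L0.
move=> D0 t0 zL h; have T0 : 0 < t + K by rewrite ltr_wpDr.
have vK := sup_tail_ge0 K.
case: ifPn => tz.
  rewrite {2}/green min_l; first by apply: green_step_inside => //;
    rewrite zL andbT; lra.
  by rewrite (sup_tail_lt0 v_sup_tail) ?exit_profile_le1//; lra.
rewrite -leNgt in tz; rewrite adde0.
have out := green_step_outside D0 t0 tz.
rewrite {2}/green /Num.min; case: ifPn => // _.
have [Tz|Tz] := ltP (- (t + K)) z.
  apply: le_trans (green_step_inside D0 t0 _ h); last by rewrite Tz.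
  by rewrite leeDl.
apply: (le_trans out); rewrite lee_fin ler_wpM2l// /exit_profile ifF; last first.
  by apply/negbTE; rewrite -leNgt.
by rewrite add0r (sup_tail_ni v_sup_tail)//; lra.
Qed.

(** The value (2 + e) a(t) is admissible for D as soon as t is large: the range
    of the affine part is 2 t + O(1) and its loss per step is at least m(t)
    (1 - o(1)). *)
Lemma green_level_exists (e : R) : 0 < e -> 2 + e / 2 <= (1 - v K) * (2 + e) ->
  exists2 t0 : R, 0 < t0 & forall t, t0 <= t ->
   1 <= (1 - v K) * ((2 + e) * ratio0 F t) / (2 * (t + K) + L) *
          (m (t + K) - p (t + K + L)).
Proof.
have lK := K0; have lL := L0.
move=> e0 vK.
(* With this choice (2 + e / 2) (1 - 2 eta) = 2 + e / 4. *)
pose eta := e / (16 + 4 * e).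
have eta0 : 0 < eta by rewrite divr_gt0//; lra.
have [t1 t10 ht1] := pos_tmean_small infinite_mean ratio_integrable eta0.
exists (t1 + (K + L) + 4 * (2 * K + L) / e).
  rewrite ltr_wpDr ?ltr_wpDr ?addr_ge0// divr_ge0 ?mulr_ge0//; last exact: ltW.
  by lra.
move=> t ht; have q0 : 0 <= 4 * (2 * K + L) / e by rewrite divr_ge0//; lra.
have tt1 : t1 <= t by lra.
have tKL : K + L <= t by lra.
have tq : 2 * K + L <= e / 4 * t.
  have : 4 * (2 * K + L) / e <= t by lra.
  by rewrite ler_pdivrMr//; lra.
have tp : 0 < t by lra.
have mt := neg_tmean_gt0 infinite_mean tp.
have m1 : m t <= m (t + K) by rewrite neg_tmean_le ?(ltW tp)//; lra.
have p1 : p (t + K + L) <= 2 * eta * m t.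
  apply: (le_trans (ht1 _ _)); first by lra.
  have tle : t <= t + K + L by lra.
  have h : m (t + K + L) <= 2 * m t.
    apply: (le_trans (neg_tmean_div_le F tp tle)).
    by rewrite ler_wpM2r ?(ltW mt)// ler_pdivrMr//; lra.
  by have := ler_wpM2l (ltW eta0) h; lra.
rewrite /ratio0 tp.
have d0 : 0 < 2 * (t + K) + L by lra.
set X := m (t + K) - p (t + K + L).
have -> : (1 - v K) * ((2 + e) * (t / m t)) / (2 * (t + K) + L) * X =
    ((1 - v K) * (2 + e)) * (t * X) / ((2 * (t + K) + L) * m t).
  by field; rewrite !gt_eqF.
rewrite ler_pdivlMr ?mulr_gt0// mul1r.
have eta1 : (2 + e / 2) * (1 - 2 * eta) = 2 + e / 4.
  by rewrite /eta; field; rewrite gt_eqF//; lra.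
have eta2 : 0 <= 1 - 2 * eta.
  rewrite -(@pmulr_rge0 _ (2 + e / 2)); last by lra.
  by rewrite eta1; lra.
have X1 : (1 - 2 * eta) * m t <= X by rewrite /X; lra.
have tX1 : t * ((1 - 2 * eta) * m t) <= t * X by rewrite ler_wpM2l// ltW.
have tX0 : 0 <= t * ((1 - 2 * eta) * m t) by rewrite !mulr_ge0// ltW.
apply: (@le_trans _ _ ((2 + e / 2) * (t * ((1 - 2 * eta) * m t)))).
  have -> : (2 + e / 2) * (t * ((1 - 2 * eta) * m t)) = (2 + e / 4) * t * m t.
    by rewrite -eta1; ring.
  by rewrite ler_wpM2r ?(ltW mt)//; lra.
apply: ler_pM => //; first by lra.
Qed.

End green_bound.

(** * The lower bound *)

Lemma clipped_step (R : realType) (s z y : R) : 0 < s ->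
  Num.max 0 (Num.min z 0 + s) <=
  Num.min (neg_part y) s + Num.max 0 (Num.min (z + y) 0 + s).
Proof.
move=> s0; set w := Num.max 0 (Num.min (z + y) 0 + s).
have w0 : 0 <= w by rewrite le_max lexx.
have ws : Num.min (z + y) 0 + s <= w by rewrite le_max lexx orbT.
have z0 : Num.min z 0 <= 0 by rewrite ge_min lexx orbT.
have zz : Num.min z 0 <= z by rewrite ge_min lexx.
have y0 := neg_part_ge0 y; have yn : - y <= neg_part y by rewrite le_max lexx.
rewrite ge_max; apply/andP; split; first by rewrite addr_ge0// le_min y0 ltW.
have [ys|_] := leP (neg_part y) s; last by lra.
by move: ws; have [zy|zy] := leP (z + y) 0; lra.
Qed.

Section lower_bound.
Variables (R : realType) (F : probability R R) (v : R -> R).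
Local Notation m := (neg_tmean F).
Hypothesis infinite_mean : ('E_F[@neg_part R] = +oo)%E.
Hypothesis ratio_integrable :
  (\int[F]_(x in `]0%R, +oo[) (x / neg_tmean F x)%:E < +oo)%E.
Hypothesis F_unbounded : forall x, (0 < F (ray x))%E.
Hypothesis v_sup_tail : sup_tail F v.

(** Up to the factor 1 / m(s), the distance from max(z, - s) to - s, truncated
    at s. *)
Definition descent (s z : R) : R :=
  Num.max 0 (Num.min z 0 + s) * inv_tmean F s.

Definition jump_mean (x z : R) : \bar R :=
  (\int[F]_y (descent (y - x) z)%:E)%E.

Lemma descent_ge0 s z : 0 <= descent s z.
Proof. by rewrite mulr_ge0 ?inv_tmean_ge0// le_max lexx. Qed.

Lemma descent_le s z : descent s z <= (if - z < s then ratio0 F s else 0).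
Proof.
rewrite /descent ratio0E; case: ifPn => zs.
  have [s0|s0] := ltP 0 s; last by rewrite /inv_tmean ltNge s0 !mulr0.
  rewrite ler_wpM2r ?inv_tmean_ge0// ge_max ltW//=.
  by rewrite gerDr ge_min lexx orbT.
move: zs; rewrite -leNgt => zs; rewrite max_l ?mul0r//.
by have : Num.min z 0 <= z; [rewrite ge_min lexx|lra].
Qed.

Lemma descent0 s : descent s 0 = ratio0 F s.
Proof.
rewrite /descent minxx add0r ratio0E; have [s0|s0] := ltP 0 s.
  by [].
by rewrite /inv_tmean ltNge s0 !mulr0.
Qed.

Lemma measurable_descent_shift x z :
  measurable_fun [set: R] (fun y => descent (y - x) z).
Proof.
have mi := measurable_inv_tmean infinite_mean.
by rewrite /descent; mfun.
Qed.

Lemma jump_mean_ge0 x z : (0 <= jump_mean x z)%E.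
Proof. by apply: integral_ge0 => y _; rewrite lee_fin descent_ge0. Qed.

Lemma measurable_jump_mean x : measurable_fun [set: R] (jump_mean x).
Proof.
have mi := measurable_inv_tmean infinite_mean.
apply: (measurable_fun_fubini_tonelli_F (m2 := F)
    (fun z : R * R => (descent (z.2 - x) z.1)%:E)).
  by rewrite /descent; mfun.
by move=> z; rewrite lee_fin descent_ge0.
Qed.

Lemma jump_mean0 x : jump_mean x 0 = (\int[F]_y (ratio0 F (y - x))%:E)%E.
Proof. by apply: eq_integral => y _; rewrite descent0. Qed.

Lemma jump_mean_le x z : (jump_mean x z <= jump_mean x 0)%E.
Proof.
have mr := measurable_ratio0 infinite_mean; have md := measurable_descent_shift.
rewrite jump_mean0; apply: ge0_le_integral => //.
- by move=> y _; rewrite lee_fin descent_ge0.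
- by mfun.
- by mfun.
move=> y _; rewrite lee_fin (le_trans (descent_le _ _))//.
by case: ifP => // _; exact: ratio0_ge0.
Qed.

Lemma jump_mean_fin x z : 0 <= x -> jump_mean x z \is a fin_num.
Proof.
move=> x0; have mr := measurable_ratio0 infinite_mean.
rewrite ge0_fin_numE ?jump_mean_ge0// (le_lt_trans (jump_mean_le x z))//.
rewrite jump_mean0; apply: le_lt_trans (ratio0_integrable ratio_integrable).
apply: ge0_le_integral => //.
- by move=> y _; rewrite lee_fin ratio0_ge0.
- by mfun.
- by mfun.
by move=> y _; rewrite lee_fin ratio0_nd//; lra.
Qed.

(** Under one step from z the distance decreases by at most min(y^-, s), and
    only when z > - s; the mean of this loss is m(s), compensated by the
    factor 1 / m(s). *)
Lemma jump_mean_step x z :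
  (jump_mean x z <= F (ray (x - z)) + \int[F]_y jump_mean x (z + y)%R)%E.
Proof.
have mi := measurable_inv_tmean infinite_mean.
have mds := measurable_descent_shift.
rewrite /jump_mean (fubini_tonelli (m1 := F) (m2 := F)
    (fun u : R * R => (descent (u.2 - x) (z + u.1))%:E))/=; last 2 first.
- by rewrite /descent; mfun.
- by move=> u; rewrite lee_fin descent_ge0.
have mG : measurable_fun [set: R]
    (fun s => \int[F]_y (descent (s - x) (z + y))%:E)%E.
  apply: (measurable_fun_fubini_tonelli_F (m2 := F)
    (fun u : R * R => (descent (u.1 - x) (z + u.2))%:E)).
    by rewrite /descent; mfun.
  by move=> u; rewrite lee_fin descent_ge0.
rewrite -integral_ray -ge0_integralD//; last 3 first.
- by move=> y _; case: ifP.
- by mfun.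
- by move=> s _; apply: integral_ge0 => y _; rewrite lee_fin descent_ge0.
apply: ge0_le_integral => //.
- by move=> y _; rewrite lee_fin descent_ge0.
- by have := mds x z => ?; mfun.
- by mfun.
move=> s' _; set s := s' - x.
have I0 : (0 <= \int[F]_y (descent s (z + y))%:E)%E.
  by apply: integral_ge0 => y _; rewrite lee_fin descent_ge0.
case: ifPn => zs; last first.
  rewrite add0e (le_trans _ I0)// lee_fin (le_trans (descent_le _ _))// ifF//.
  by apply/negbTE; rewrite -leNgt /s; move: zs; rewrite -leNgt; lra.
have [s0|s0] := ltP 0 s; last first.
  by rewrite {1}/descent /inv_tmean ltNge s0 mulr0 adde_ge0.
have -> : (1 = (inv_tmean F s)%:E * (m s)%:E)%E.
  by rewrite /inv_tmean s0 -EFinM mulVf// gt_eqF// neg_tmean_gt0.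
rewrite neg_tmeanE ?(ltW s0)// -ge0_integralZl_EFin ?inv_tmean_ge0//; last 2 first.
- by move=> y _; rewrite lee_fin le_min neg_part_ge0 ltW.
- by mfun.
rewrite -ge0_integralD//; last 4 first.
- move=> y _; rewrite mule_ge0// lee_fin ?inv_tmean_ge0//.
  by rewrite le_min neg_part_ge0 ltW.
- by mfun.
- by move=> y _; rewrite lee_fin descent_ge0.
- by rewrite /descent; mfun.
rewrite -[leLHS](cst_integral F); apply: ge0_le_integral => //.
- by move=> y _; rewrite lee_fin descent_ge0.
- by rewrite /descent; mfun.
move=> y _; rewrite -EFinM -EFinD lee_fin /descent.
rewrite (mulrC (inv_tmean F s) (Num.min _ _)) -mulrDl ler_wpM2r ?inv_tmean_ge0//.
exact: clipped_step.
Qed.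

Lemma jump_mean_small x (e : R) : 0 <= x -> 0 < e ->
  exists2 t0 : R, 0 < t0 & forall z, z <= - t0 -> (jump_mean x z <= e%:E)%E.
Proof.
move=> x0 e0; have mr := measurable_ratio0 infinite_mean.
have [||||c c0 hc] := @tail_integral_small _ _ _ F id
  (EFin \o ratio0 F) _ _ _ _ _ e0 => //.
- by mfun.
- by move=> y; rewrite lee_fin ratio0_ge0.
- exact: ratio0_integrable.
exists c => // z zc; apply: le_trans (hc c (lexx c)).
have md := measurable_descent_shift x z.
apply: ge0_le_integral => //.
- by move=> y _; rewrite lee_fin descent_ge0.
- by mfun.
- by mfun.
move=> y _ /=; have [cy|cy] := ltP c y.
  rewrite lee_fin (le_trans (descent_le _ _))//.
  by case: ifP => // _; [rewrite ratio0_nd//; lra|exact: ratio0_ge0].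
rewrite lee_fin (le_trans (descent_le _ _))// ifF//.
by apply/negbTE; rewrite -leNgt; lra.
Qed.

(** For z <= x, jump_mean is at most the probability of passing x in the next
    step plus its mean after this step, so that it would be at most (1 +
    J(x)) v (x - z) if the walk surely left every half-line ]-t, oo[ for
    ever. This transience is replaced by the function green, which decreases
    by 1 at each visit to ]-t, x]. *)
Lemma sup_tail_lower x : 0 <= x ->
  fine (\int[F]_y (ratio0 F (y - x))%:E) <=
  (1 + fine (\int[F]_y (ratio0 F (y - x))%:E)) * v x.
Proof.
move=> x0; rewrite -jump_mean0.
pose h z := fine (jump_mean x z).
have hE z : (h z)%:E = jump_mean x z by rewrite fineK// jump_mean_fin.
have h0 z : 0 <= h z by rewrite fine_ge0// jump_mean_ge0.
have hle z : h z <= h 0 by rewrite -lee_fin !hE jump_mean_le.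
have mh : measurable_fun [set: R] h.
  by apply/measurable_EFinP; rewrite (_ : EFin \o h = jump_mean x);
    [exact: measurable_jump_mean|exact/funext].
have mv := measurable_sup_tail v_sup_tail.
have v0 y := sup_tail_ge0 v_sup_tail y.
rewrite -/(h 0); apply/ler_addgt0Pr => eta eta0.
have e6 : (0 : R) < 1 / 6 by rewrite divr_gt0.
(* The bound 1 / 6 makes D = 3 a(t) admissible. *)
have [K K0 vK] := sup_tail_small infinite_mean ratio_integrable F_unbounded
  v_sup_tail e6.
have {}vK := vK _ (lexx K).
have h25 : 2 + 1 / 2 <= (1 - v K) * (2 + 1) by lra.
have [t1 t10 ht1] := green_level_exists infinite_mean ratio_integrable
  (ltW K0) x0 ltr01 h25.
have [t2 t20 ht2] := jump_mean_small x0 eta0.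
pose t := Num.max t1 t2.
have t0 : 0 < t by rewrite lt_max t10.
pose D := (2 + 1) * ratio0 F t.
have D0 : 0 <= D by rewrite mulr_ge0 ?ratio0_ge0.
pose g := green v K x D t.
have g0 z : 0 <= g z.
  exact: (green_ge0 v_sup_tail (ltW K0) x0).
have mg : measurable_fun [set: R] g by exact: (measurable_green v_sup_tail
  (ltW K0) x0).
have gstep z : z <= x ->
    (\int[F]_y (if (z + y <= x)%R then (g (z + y))%:E else 0)
    + (if (- t < z)%R then 1 else 0) <= (g z)%:E)%E.
  move=> zx; apply: (green_excessive v_sup_tail (ltW K0) x0) => //.
  by apply: ht1; rewrite le_max lexx.
have hsmall z : z <= - t -> h z <= eta.
  move=> zt; rewrite -lee_fin hE ht2// (le_trans zt)// lerN2.
  by rewrite le_max lexx orbT.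
have claim (n : nat) z : z <= x ->
    n%:R * h z <= n%:R * ((1 + h 0) * v (x - z) + eta) + h 0 * g z.
  elim: n z => [|n IH] z zx.
    by rewrite !mul0r add0r mulr_ge0.
  have n0 : 0 <= n%:R :> R by rewrite ler0n.
  pose I := (\int[F]_y (if (z + y <= x)%R then (g (z + y))%:E else 0))%E.
  have If : I \is a fin_num.
    rewrite ge0_fin_numE; last first.
      by apply: integral_ge0 => y _; case: ifP => // _; rewrite lee_fin.
    apply: (@le_lt_trans _ _ (g z)%:E); last by rewrite ltry.
    by apply: le_trans (gstep _ zx); rewrite leeDl//; case: ifP.
  have : ((n%:R * h z)%:E <=
      (n%:R * eta)%:E + (n%:R * (1 + h 0))%:E * (v (x - z))%:E + (h 0)%:E * I)%E.
    apply: (@le_trans _ _ ((n%:R)%:E * F (ray (x - z))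
       + \int[F]_y (n%:R * h (z + y))%:E)%E).
      under eq_integral do rewrite EFinM.
      rewrite ge0_integralZl_EFin//; last 2 first.
      - by move=> y _; rewrite lee_fin.
      - by mfun.
      rewrite -ge0_muleDr//; last by apply: integral_ge0 => y _; rewrite lee_fin.
      rewrite EFinM lee_wpmul2l ?lee_fin// hE (le_trans (jump_mean_step x z))//.
      by rewrite leeD2l// le_eqVlt; apply/orP; left;
        apply/eqP/eq_integral => y _; rewrite hE.
    apply: (@le_trans _ _ ((n%:R * eta)%:E + (n%:R * (1 + h 0))%:E *
      (\int[F]_y (v (x - z - y))%:E) + (h 0)%:E * I)%E); last first.
      rewrite leeD2r// leeD2l// lee_wpmul2l//.
        by rewrite lee_fin mulr_ge0// addr_ge0.
      by apply: (sup_tail_excessive v_sup_tail); lra.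
    have nh0 : 0 <= n%:R * (1 + h 0) by rewrite mulr_ge0// addr_ge0.
    have B20 y : (0 <= (n%:R * (1 + h 0))%:E * (v (x - z - y))%:E)%E.
      by rewrite -EFinM lee_fin mulr_ge0.
    have B30 y : (0 <= (h 0)%:E * (if (z + y <= x)%R then (g
      (z + y))%:E else 0%E))%E.
      by rewrite mule_ge0 ?lee_fin//; case: ifP => // _; rewrite lee_fin.
    rewrite [leRHS](_ : _ = \int[F]_y ((n%:R * eta)%:E
        + (n%:R * (1 + h 0))%:E * (v (x - z - y))%:E
        + (h 0)%:E * (if (z + y <= x)%R then (g (z + y))%:E else 0)))%E; last first.
      rewrite ge0_integralD//; last 3 first.
      - by move=> y _; rewrite adde_ge0// lee_fin mulr_ge0// ltW.
      - by mfun.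
      - by mfun.
      rewrite ge0_integralD//; last 2 first.
      - by move=> y _; rewrite lee_fin mulr_ge0// ltW.
      - by mfun.
      rewrite cst_integral ge0_integralZl_EFin//; last 2 first.
      - by move=> y _; rewrite lee_fin.
      - by mfun.
      rewrite ge0_integralZl_EFin//; last by mfun.
      by move=> y _; case: ifP => // _; rewrite lee_fin.
    rewrite -integral_ray -ge0_integralZl_EFin//; last 2 first.
    - by move=> y _; case: ifP.
    - by mfun.
    have C0 y : (0 <= (n%:R)%:E * (if (x - z < y)%R then 1 else 0) :> \bar R)%E.
      by rewrite mule_ge0 ?lee_fin//; case: ifP.
    rewrite -ge0_integralD//; last 3 first.
    - by mfun.
    - by move=> y _; rewrite lee_fin mulr_ge0.
    - by mfun.
    apply: ge0_le_integral => //.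
    - by move=> y _; rewrite adde_ge0// lee_fin mulr_ge0.
    - by mfun.
    - by mfun.
    move=> y _; have [zyx|zyx] := leP (z + y) x.
      rewrite ifF ?mule0 ?add0e; last by apply/negbTE; rewrite -leNgt; lra.
      rewrite -!EFinM -!EFinD lee_fin; have := IH _ zyx.
      by rewrite (_ : x - (z + y) = x - z - y); [lra|ring].
    rewrite ifT; last by lra.
    rewrite (sup_tail_lt0 v_sup_tail); last by lra.
    rewrite !mule1 mule0 adde0 -!EFinD lee_fin.
    have : n%:R * h (z + y) <= n%:R * h 0 by rewrite ler_wpM2l.
    have : 0 <= n%:R * eta by rewrite mulr_ge0// ltW.
    by lra.
  have hz : h z <= eta + h 0 * (if - t < z then 1 else 0).
    case: ifPn => tz; first by rewrite mulr1 (le_trans (hle z))// lerDr ltW.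
    by rewrite mulr0 addr0 hsmall// leNgt.
  have := gstep _ zx; rewrite -/I -(fineK If).
  rewrite (_ : (if (- t < z)%R then 1%E else 0%E) =
    (if - t < z then 1 else 0 : R)%:E);
    last by case: ifP.
  rewrite -EFinD -!EFinM -!EFinD !lee_fin; move: (fine I) => i.
  move: hz; set ind := (if _ then _ else _) => hz gi hn.
  have hgi : h 0 * (i + ind) <= h 0 * g z by rewrite ler_wpM2l.
  have v1 : 0 <= (1 + h 0) * v (x - z) by rewrite mulr_ge0// addr_ge0.
  by rewrite -natr1 !mulrDl !mul1r; lra.
rewrite leNgt; apply/negP => lt.
pose d := h 0 - ((1 + h 0) * v x + eta).
have d0 : 0 < d by rewrite /d; lra.
(* The claim divided by n, for n large, contradicts the gap d. *)
pose n := Num.bound (h 0 * g 0 / d).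
have : h 0 * g 0 / d < n%:R by apply: archi_boundP; apply: divr_ge0;
  [exact: mulr_ge0|exact: ltW].
rewrite ltr_pdivrMr// /d; have := claim n 0 x0; rewrite subr0.
by rewrite mulrBr; lra.
Qed.

End lower_bound.

(** * Splitting the path at its first passage above a fixed level *)

Section stage.
Variables (R : realType) (F G : probability R R) (v : R -> R).
Local Notation m := (neg_tmean F).
Hypothesis infinite_mean : ('E_F[@neg_part R] = +oo)%E.
Hypothesis v_sup_tail : sup_tail F v.
Variables (e K t0 : R).
Hypotheses (e0 : 0 < e) (K0 : 0 <= K) (t00 : 0 < t0).
Hypothesis level : forall t, t0 <= t ->
  1 <= (1 - v K) * ((2 + e) * ratio0 F t) / (2 * (t + K) + K) *
         (m (t + K) - pos_tmean F (t + K + K)).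

(** For t < t0, where the Green function bound may fail, the larger set ]-t0, K]
    is used. *)
Definition occupation (t z : R) : R :=
  green v K K ((2 + e) * ratio0 F (Num.max t t0)) (Num.max t t0) z.

(** For z <= K <= s, a majorant of the probability that the first position above
    K of the walk started at z is above s; for z > K, the indicator of z >
    s. *)
Definition overshoot (s z : R) : \bar R :=
  if z <= K then
    (\int[F]_y (if (s - K < y)%R then (occupation (y - s) z)%:E else 0))%E
  else if s < z then 1%E else 0%E.

Let max_gt0 t : 0 < Num.max t t0.
Proof. by rewrite lt_max t00 orbT. Qed.

Let D_ge0 t : 0 <= (2 + e) * ratio0 F t.
Proof. by rewrite mulr_ge0 ?ratio0_ge0// addr_ge0// ltW. Qed.

Lemma occupation_ge0 t z : 0 <= occupation t z.
Proof. exact: (green_ge0 v_sup_tail K0 K0). Qed.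

Lemma occupation_le t z : occupation t z <= (2 + e) * ratio0 F (Num.max t t0).
Proof. exact: (green_le v_sup_tail). Qed.

Lemma measurable_occupation :
  measurable_fun [set: R * R] (fun u => occupation u.1 u.2).
Proof.
have mr := measurable_ratio0 infinite_mean.
apply: (@measurable_green_pair _ _ _ v_sup_tail _ _ K0 K0
  (fun t => (2 + e) * ratio0 F (Num.max t t0)) (fun t => Num.max t t0)) => //.
  by mfun.
by mfun.
Qed.

Lemma overshoot_ge0 s z : (0 <= overshoot s z)%E.
Proof.
rewrite /overshoot; case: ifP => _; last by case: ifP.
by apply: integral_ge0 => y _; case: ifP => // _; rewrite lee_fin occupation_ge0.
Qed.

Lemma measurable_overshoot :
  measurable_fun [set: R * R] (fun u => overshoot u.1 u.2).
Proof.
have mo := measurable_occupation.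
have m1 : measurable_fun [set: R * R] (fun u : R * R =>
    \int[F]_y (if (u.1 - K < y)%R then (occupation (y - u.1) u.2)%:E else 0))%E.
  apply: (measurable_fun_fubini_tonelli_F (m2 := F) (fun u : (R * R) * R =>
    if (u.1.1 - K < u.2)%R then (occupation (u.2 - u.1.1) u.1.2)%:E else 0%E)).
    apply: measurable_fun_ifT.
    - apply: measurable_fun_ltr => //.
      apply: measurable_funB => //;
        exact: (measurableT_comp measurable_fst measurable_fst).
    - apply/measurable_EFinP.
      have h : measurable_fun [set: (R * R) * R] (fun u => (u.2 - u.1.1, u.1.2)).
        apply: measurable_fun_pair.
          apply: measurable_funB => //;
            exact: (measurableT_comp measurable_fst measurable_fst).
        exact: (measurableT_comp measurable_snd measurable_fst).
      exact: (measurableT_comp mo h).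
    - exact: measurable_cst.
  by move=> u; case: ifP => // _; rewrite lee_fin occupation_ge0.
by rewrite /overshoot; mfun.
Qed.

Lemma measurable_overshoot_shift s z :
  measurable_fun [set: R] (fun y => overshoot s (z + y)).
Proof.
have mo := measurable_overshoot.
have h : measurable_fun [set: R] (fun y : R => (s, z + y)).
  by apply: measurable_fun_pair; mfun.
exact: (measurableT_comp mo h).
Qed.

(** The probability F(]s - z, oo[) of jumping from z above s is the integral
    over u of the indicator of - (u - s) < z, which occupation loses in one
    step. *)
Lemma overshoot_excessive s z : K <= s -> z <= K ->
  (\int[F]_y overshoot s (z + y)%R <= overshoot s z)%E.
Proof.
move=> Ks zK; have mo := measurable_occupation.
pose k (y u : R) : \bar R := if (z + y <= K) && (s - K < u) then
  (occupation (u - s) (z + y))%:E else 0%E.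
have k0 y u : (0 <= k y u)%E.
  by rewrite /k; case: ifP => // _; rewrite lee_fin occupation_ge0.
have mk : measurable_fun [set: R * R] (fun p => k p.1 p.2).
  apply: measurable_fun_ifT; [by mfun| |exact: measurable_cst].
  apply/measurable_EFinP.
  have h : measurable_fun [set: R * R] (fun p => (p.2 - s, z + p.1)).
    by apply: measurable_fun_pair; mfun.
  exact: (measurableT_comp mo h).
have mF : measurable_fun [set: R] (fun y => \int[F]_u k y u)%E.
  exact: (measurable_fun_fubini_tonelli_F (m2 := F) (fun p : R * R => k p.1 p.2)).
have mG : measurable_fun [set: R] (fun u => \int[F]_y k y u)%E.
  exact: (measurable_fun_fubini_tonelli_G (m1 := F) (fun p : R * R => k p.1 p.2)).
have -> : (\int[F]_y overshoot s (z + y)%R =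
    \int[F]_y ((\int[F]_u k y u) + (if (s - z < y)%R then 1 else 0)))%E.
  apply: eq_integral => y _; rewrite /overshoot /k; case: ifPn => zy /=.
    by rewrite ifF ?adde0//; apply/negbTE; rewrite -leNgt; lra.
  rewrite integral0 add0e (_ : (s < z + y) = (s - z < y))//.
  by rewrite ltrBlDl.
rewrite ge0_integralD//; last 3 first.
- by move=> y _; exact: integral_ge0.
- by move=> y _; case: ifP.
- by mfun.
rewrite (fubini_tonelli (m1 := F) (m2 := F) (fun p : R * R => k p.1 p.2))//=.
rewrite -ge0_integralD//; last 3 first.
- by move=> y _; exact: integral_ge0.
- by move=> y _; case: ifP.
- by mfun.
rewrite /overshoot zK; apply: ge0_le_integral => //.
- by move=> u _; rewrite adde_ge0//; [exact: integral_ge0|case: ifP].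
- by mfun.
- apply: measurable_fun_ifT; [by mfun| |exact: measurable_cst].
  apply/measurable_EFinP.
  have h : measurable_fun [set: R] (fun y : R => (y - s, z)).
    by apply: measurable_fun_pair; mfun.
  exact: (measurableT_comp mo h).
move=> u _; have [us|us] := ltP (s - K) u; last first.
  rewrite ifF; last by apply/negbTE; rewrite -leNgt; lra.
  by rewrite adde0 integral0_eq// => y _; rewrite /k ltNge us andbF.
rewrite /k us /=.
apply: le_trans (green_excessive v_sup_tail K0 K0 (D_ge0 (Num.max (u - s) t0))
  (max_gt0 (u - s)) zK _); last first.
  by apply: level; rewrite le_max lexx orbT.
apply: leeD.
  rewrite le_eqVlt; apply/orP; left; apply/eqP/eq_integral => y _.
  by rewrite andbT.
case: ifPn => szu; last by case: ifP.
rewrite ifT//.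
have : u - s <= Num.max (u - s) t0 by rewrite le_max lexx.
by lra.
Qed.

Lemma overshoot0_le s :
  (overshoot s 0 <= (2 + e)%:E *
    \int[F]_y (if (s - K < y)%R then (ratio0 F (Num.max (y - s) t0))%:E else 0))%E.
Proof.
have mo := measurable_occupation; have mr := measurable_ratio0 infinite_mean.
rewrite /overshoot K0 -ge0_integralZl_EFin//; last 3 first.
- by move=> y _; case: ifP => // _; rewrite lee_fin ratio0_ge0.
- by mfun.
- by rewrite addr_ge0// ltW.
apply: ge0_le_integral => //.
- by move=> y _; case: ifP => // _; rewrite lee_fin occupation_ge0.
- apply: measurable_fun_ifT; [by mfun| |exact: measurable_cst].
  apply/measurable_EFinP.
  have h : measurable_fun [set: R] (fun y : R => (y - s, 0 : R)).
    by apply: measurable_fun_pair; mfun.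
  exact: (measurableT_comp mo h).
- by mfun.
move=> y _; case: ifP => _; last by rewrite mule0.
by rewrite -EFinM lee_fin occupation_le.
Qed.

(** After its first passage above K, the walk is above x - A, or it is at some y
    <= x - A and passes the remaining height x - y >= A with probability at
    most q G(]x - y, oo[). This tail is split at x - A, and the mass of the
    r below x - A is the integral of the indicator of y > x - r, to which
    overshoot applies. *)
Lemma stage_inequality (x A q : R) : K <= A -> A + K <= x -> 0 <= q ->
  (forall y, A <= y -> y <= x - K -> v y <= q * tail G y) ->
  ((v x)%:E <= overshoot (x - A) 0
    + q%:E * \int[G]_r (if ((A < r) && (r <= x - A))%R then overshoot
      (x - r) 0 else 0)
    + (q * tail G (x - A))%:E * (v K)%:E)%E.
Proof.
move=> KA AKx q0 hv; have lK := K0; have mv := measurable_sup_tail v_sup_tail.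
have v0 := sup_tail_ge0 v_sup_tail; have mo := measurable_overshoot.
have tailE y : (tail G y)%:E = G (ray y) by rewrite fineK//; exact: fin_num_measure.
have tail0 y : 0 <= tail G y by rewrite fine_ge0.
pose k z r : \bar R := if (A < r) && (r <= x - A) then overshoot (x - r) z else 0%E.
have k0 z r : (0 <= k z r)%E by rewrite /k; case: ifP => // _; exact: overshoot_ge0.
have mk : measurable_fun [set: R * R] (fun p => k p.1 p.2).
  apply: measurable_fun_ifT; [by mfun| |exact: measurable_cst].
  have h : measurable_fun [set: R * R] (fun p => (x - p.2, p.1)).
    by apply: measurable_fun_pair; mfun.
  exact: (measurableT_comp mo h).
pose w z := (overshoot (x - A) z + q%:E * (\int[G]_r k z r)
    + (q * tail G (x - A))%:E * (v (K - z))%:E)%E.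
have Ik0 z : (0 <= \int[G]_r k z r)%E by exact: integral_ge0.
have qt0 : 0 <= q * tail G (x - A) by rewrite mulr_ge0.
have w3 z : (0 <= (q * tail G (x - A))%:E * (v (K - z))%:E)%E.
  by rewrite -EFinM lee_fin mulr_ge0.
have w2 z : (0 <= q%:E * (\int[G]_r k z r))%E by rewrite mule_ge0.
have w0 z : (0 <= w z)%E by rewrite !adde_ge0// overshoot_ge0.
have mIk : measurable_fun [set: R] (fun z => \int[G]_r k z r)%E.
  exact: (measurable_fun_fubini_tonelli_F (m2 := G) (fun p : R * R => k p.1 p.2)).
have mo1 s : measurable_fun [set: R] (overshoot s).
  exact: (measurableT_comp mo (pair1_measurable s)).
have mw : measurable_fun [set: R] w by have := mo1 (x - A) => ?; rewrite /w; mfun.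
have Ik_excessive z : z <= K -> (\int[F]_y \int[G]_r k
  (z + y)%R r <= \int[G]_r k z r)%E.
  move=> zK.
  have mkz : measurable_fun [set: R * R] (fun p : R * R => k (z + p.1)%R p.2).
    have h : measurable_fun [set: R * R] (fun p => (z + p.1, p.2)).
      by apply: measurable_fun_pair; mfun.
    exact: (measurableT_comp mk h).
  rewrite (fubini_tonelli (m1 := F) (m2 := G) (fun p : R * R =>
    k (z + p.1)%R p.2))//=.
  apply: ge0_le_integral => //.
  - by move=> r _; exact: integral_ge0.
  - exact: (measurable_fun_fubini_tonelli_G (m1 := F) (fun p : R * R =>
    k (z + p.1)%R p.2)).
  - exact: (measurableT_comp mk (pair1_measurable z)).
  move=> r _; rewrite /k; case: ifPn => [/andP[Ar rx]|_]; last by rewrite integral0.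
  by apply: overshoot_excessive => //; lra.
have w_excessive z : z <= K -> (\int[F]_y w (z + y)%R <= w z)%E.
  move=> zK; have mos := measurable_overshoot_shift (x - A) z.
  have mIkz : measurable_fun [set: R] (fun y => \int[G]_r k (z + y)%R r)%E.
    have h : measurable_fun [set: R] (fun y : R => z + y) by mfun.
    exact: (measurableT_comp mIk h).
  rewrite /w ge0_integralD//; last 3 first.
  - by move=> y _; rewrite adde_ge0// overshoot_ge0.
  - by mfun.
  - by mfun.
  rewrite ge0_integralD//; last 2 first.
  - by move=> y _; exact: overshoot_ge0.
  - by mfun.
  rewrite ge0_integralZl_EFin// ge0_integralZl_EFin//; last 2 first.
  - by move=> y _; rewrite lee_fin.
  - by mfun.
  apply: leeD; last first.
    rewrite lee_wpmul2l//.
    rewrite (_ : (\int[F]_y (v (K - (z + y)))%:E = \int[F]_y (v (K - z - y))%:E)%E);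
      last by apply: eq_integral => y _; rewrite opprD addrA.
    by apply: (sup_tail_excessive v_sup_tail); lra.
  apply: leeD; first by apply: overshoot_excessive => //; lra.
  by rewrite lee_wpmul2l// Ik_excessive.
have bound z : K < z -> ((v (x - z))%:E <= w z)%E.
  move=> Kz; have nz : (z <= K) = false by apply/negbTE; rewrite -ltNge.
  have [zx|zx] := ltP (x - A) z.
    apply: (@le_trans _ _ 1%E).
      by rewrite lee_fin (sup_tail_le1 v_sup_tail).
    rewrite /w -addeA; apply: (@le_trans _ _ (overshoot (x - A) z)).
      by rewrite /overshoot nz zx.
    by rewrite leeDl// adde_ge0.
  apply: (@le_trans _ _ (q%:E * (tail G (x - z))%:E)%E).
    by rewrite -EFinM lee_fin hv//; lra.
  rewrite /w (sup_tail_lt0 v_sup_tail); last by lra.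
  have cover : (G (ray (x - z)) <= \int[G]_r k z r + G (ray (x - A)))%E.
    rewrite -!integral_ray -ge0_integralD//; last 3 first.
    - exact: (measurableT_comp mk (pair1_measurable z)).
    - by move=> r _; case: ifP.
    - by mfun.
    apply: ge0_le_integral => //.
    - by move=> r _; case: ifP.
    - by mfun.
    - apply: emeasurable_funD; last by mfun.
      exact: (measurableT_comp mk (pair1_measurable z)).
    move=> r _; case: ifPn => xzr; last by rewrite adde_ge0//; case: ifP.
    have [xAr|rxA] := ltP (x - A) r; first by rewrite leeDr.
    rewrite adde0 /k rxA andbT ifT; last by lra.
    by rewrite /overshoot nz ifT//; lra.
  apply: (@le_trans _ _ (q%:E * (\int[G]_r k z r + G (ray (x - A))))%E).
    by rewrite tailE lee_wpmul2l.
  rewrite ge0_muleDr// mule1 EFinM tailE -addeA.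
  by rewrite leeDr// overshoot_ge0.
have vw : forall g, ((v g)%:E <= w (x - g)%R)%E.
  apply: (sup_tail_minimal v_sup_tail (c := x - K) (w := fun g => w (x - g)%R)).
  - by lra.
  - have h : measurable_fun [set: R] (fun g : R => x - g) by mfun.
    exact: (measurableT_comp mw h).
  - by move=> g.
  - move=> g gx; have := bound (x - g); rewrite opprB addrCA subrr addr0; apply.
    by lra.
  - move=> g gx; rewrite (_ : (\int[F]_y w (x - (g - y))%R = \int[F]_y w
    (x - g + y)%R)%E);
      last by apply: eq_integral => y _; congr w; ring.
    by apply: w_excessive; lra.
by have := vw x; rewrite subrr /w subr0.
Qed.

End stage.

(** * The integrated tail *)

Section stieltjes.
Variables (R : realType) (F : probability R R).
Hypothesis infinite_mean : ('E_F[@neg_part R] = +oo)%E.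
Local Notation lam := (lebesgue_stieltjes_measure (neg_ratio F)).
Local Notation g := (neg_ratio F).
Local Notation m := (neg_tmean F).

Definition integrated_tail (x : R) : \bar R :=
  (\int[lam]_(t in ray 0) F (ray (x + t)))%E.

Lemma stieltjes_itv (a b : R) : a <= b -> lam `]a, b]%classic = (g b - g a)%:E.
Proof.
move=> ab; rewrite /lebesgue_stieltjes_measure /measure_extension /=.
rewrite measurable_mu_extE/=; last by exists (a, b).
by rewrite wlength_itv_bnd.
Qed.

Lemma integrated_tailE x :
  integrated_tail x = (\int[F]_y lam `]0%R, (y - x)%R[%classic)%E.
Proof.
pose k (t y : R) : \bar R := if (0 < t) && (x + t < y) then 1%E else 0%E.
have k0 t y : (0 <= k t y)%E by rewrite /k; case: ifP.
have mk : measurable_fun [set: measurableTypeR R * R] (fun p => k p.1 p.2).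
  by rewrite /k; mfun.
transitivity (\int[lam]_t \int[F]_y k t y)%E.
  rewrite /integrated_tail integral_mkcond; apply: eq_integral => t _.
  rewrite patchE; case: ifPn.
    rewrite inE /= in_itv/= andbT => t0; rewrite -integral_ray.
    by apply: eq_integral => y _; rewrite /k t0.
  rewrite notin_setE /= in_itv/= andbT => /negP/negbTE t0.
  by rewrite integral0_eq// => y _; rewrite /k t0.
rewrite (fubini_tonelli (m1 := lam) (m2 := F) (fun p => k p.1 p.2))//=.
apply: eq_integral => y _.
rewrite -[in RHS](setIT `]0, (y - x)%R[%classic) -integral_indic//.
apply: eq_integral => t _; rewrite indicE /k.
case: ifPn => h; first by rewrite mem_set//= in_itv/= ltrBrDl.
by rewrite memNset//= in_itv/= ltrBrDl; exact/negP.
Qed.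

Lemma measurable_stieltjes_gap x :
  measurable_fun [set: R] (fun y => lam `]0%R, (y - x)%R[%classic).
Proof.
pose k (t y : R) : \bar R := if (0 < t) && (x + t < y) then 1%E else 0%E.
have k0 t y : (0 <= k t y)%E by rewrite /k; case: ifP.
have mk : measurable_fun [set: measurableTypeR R * R] (fun p => k p.1 p.2).
  by rewrite /k; mfun.
rewrite (_ : (fun y => _) = fun y => \int[lam]_t k t y)%E; last first.
  apply/funext => y; rewrite -[LHS](congr1 lam (setIT `]0, (y - x)%R[%classic)).
  rewrite -integral_indic//; apply: eq_integral => t _; rewrite indicE /k.
  case: ifPn => h; first by rewrite mem_set//= in_itv/= ltrBrDl.
  by rewrite memNset//= in_itv/= ltrBrDl; exact/negP.
exact: (measurable_fun_fubini_tonelli_G (m1 := lam) (fun p => k p.1 p.2)).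
Qed.

Lemma neg_ratio0_ge0 : 0 <= g 0.
Proof.
rewrite /neg_ratio ltxx; apply: lb_le_inf.
  by exists (1 / m 1); exists 1 => //=; rewrite in_itv/= ltr01.
move=> _ [s /= + <-]; rewrite in_itv/= andbT => s0.
by rewrite divr_ge0 ?neg_tmean_ge0// ltW.
Qed.

Lemma neg_ratio_gt0 t : 0 < t -> g t = ratio0 F t.
Proof. by rewrite /neg_ratio /ratio0 => ->. Qed.

Lemma stieltjes_gap_le u : (lam `]0%R, u[%classic <= (ratio0 F u)%:E)%E.
Proof.
have [u0|u0] := leP u 0.
  by rewrite set_itv_ge ?measure0 ?lee_fin ?ratio0_ge0// bnd_simp -leNgt.
apply: (@le_trans _ _ (lam `]0%R, u]%classic)).
  by apply: le_measure; rewrite ?inE//; exact: subset_itv_oo_oc.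
rewrite stieltjes_itv ?(ltW u0)// neg_ratio_gt0// lee_fin gerBl.
exact: neg_ratio0_ge0.
Qed.

(** The open interval contains ]0, u / c], and a(u) <= c a(u / c). *)
Lemma stieltjes_gap_ge c u : 1 < c ->
  ((ratio0 F u)%:E <= c%:E * (lam `]0%R, u[%classic + (g 0)%:E))%E.
Proof.
move=> c1; have c0 : 0 < c by rewrite (lt_trans _ c1).
have [u0|u0] := leP u 0.
  rewrite {1}/ratio0 ltNge u0 /=.
  by rewrite mule_ge0 ?lee_fin ?(ltW c0)// adde_ge0// lee_fin neg_ratio0_ge0.
have uc : 0 < u / c by rewrite divr_gt0.
apply: (@le_trans _ _ (c%:E * (lam `]0%R, (u / c)%R]%classic + (g 0)%:E))%E).
  rewrite stieltjes_itv ?(ltW uc)// -EFinD subrK neg_ratio_gt0// -EFinM lee_fin.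
  by rewrite -{1}(divfK (lt0r_neq0 c0) u) mulrC ratio0M// ltW.
rewrite lee_wpmul2l ?lee_fin ?(ltW c0)// leeD2r//.
apply: le_measure; rewrite ?inE// => z /=; rewrite !in_itv/= => /andP[-> zu] /=.
by rewrite (le_lt_trans zu)// ltr_pdivrMr// ltr_pMr.
Qed.

Lemma integrated_tail_le x :
  (integrated_tail x <= \int[F]_y (ratio0 F (y - x))%:E)%E.
Proof.
have mr := measurable_ratio0 infinite_mean; have ml := measurable_stieltjes_gap x.
rewrite integrated_tailE; apply: ge0_le_integral => //.
  by mfun.
by move=> y _; exact: stieltjes_gap_le.
Qed.

(** Replacing y - s by t0 and leaving out the value of the ratio at 0 costs a
    bounded amount on y > s - K. *)
Lemma ratio_tail_le (c s K t0 : R) : 1 < c -> 0 <= K ->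
  (\int[F]_y (if (s - K < y)%R then (ratio0 F (Num.max (y - s) t0))%:E else 0)
   <= c%:E * integrated_tail s + (ratio0 F t0 + c * g 0)%:E * F (ray (s - K)))%E.
Proof.
move=> c1 K0; have mr := measurable_ratio0 infinite_mean.
have ml := measurable_stieltjes_gap s.
have c0 : 0 <= c by lra.
have C0 : 0 <= ratio0 F t0 + c * g 0.
  by rewrite addr_ge0 ?ratio0_ge0// mulr_ge0// neg_ratio0_ge0.
rewrite integrated_tailE -integral_ray -!ge0_integralZl_EFin//; last 2 first.
- by move=> y _; case: ifP.
- by mfun.
rewrite -ge0_integralD//; last 4 first.
- by move=> y _; rewrite mule_ge0// lee_fin.
- by mfun.
- by move=> y _; rewrite mule_ge0 ?lee_fin//; case: ifP.
- by mfun.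
apply: ge0_le_integral => //.
- by move=> y _; case: ifP => // _; rewrite lee_fin ratio0_ge0.
- by mfun.
- by mfun.
move=> y _; case: ifPn => sy; last by rewrite mule0 adde0 mule_ge0.
rewrite mule1; apply: (@le_trans _ _ ((ratio0 F (y - s))%:E + (ratio0 F t0)%:E)%E).
  rewrite -EFinD lee_fin /Num.max; case: ifP => _.
    by rewrite lerDr ratio0_ge0.
  by rewrite lerDl ratio0_ge0.
rewrite (addrC (ratio0 F t0)) EFinD addeA leeD2r// EFinM -ge0_muleDr//.
  exact: stieltjes_gap_ge.
by rewrite lee_fin neg_ratio0_ge0.
Qed.

(** The tail at s + T is smaller than the tails at s + t for t <= T, and ]0, T]
    has measure a(T) - a(0). *)
Lemma integrated_tail_ge (s T : R) : 0 < T -> g 0 <= ratio0 F T ->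
  ((ratio0 F T - g 0)%:E * F (ray (s + T)) <= integrated_tail s)%E.
Proof.
move=> T0 gT; have ml := measurable_stieltjes_gap s.
rewrite integrated_tailE -integral_ray -!ge0_integralZl_EFin//; last 3 first.
- by move=> y _; case: ifP.
- by mfun.
- by rewrite subr_ge0.
apply: ge0_le_integral => //.
- by move=> y _; rewrite mule_ge0 ?lee_fin ?subr_ge0//; case: ifP.
- by mfun.
move=> y _; case: ifPn => sT; last by rewrite mule0.
rewrite mule1 -neg_ratio_gt0// -stieltjes_itv ?(ltW T0)//.
apply: le_measure; rewrite ?inE// => z /=; rewrite !in_itv/= => /andP[-> zT] /=.
by lra.
Qed.

End stieltjes.

Section long_tails.
Variables (R : realType) (F : probability R R).
Hypothesis F_long : long_tailed F.

Lemma tailE (x : R) : (tail F x)%:E = F (ray x).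
Proof. by rewrite fineK//; exact: fin_num_measure. Qed.

Lemma tail_ge0 (x : R) : 0 <= tail F x.
Proof. by rewrite fine_ge0. Qed.

Lemma tail_le1 (x : R) : tail F x <= 1.
Proof. by rewrite -lee_fin tailE probability_le1. Qed.

Lemma tail_ni (x y : R) : x <= y -> tail F y <= tail F x.
Proof.
move=> xy; rewrite -lee_fin !tailE; apply: le_measure; rewrite ?inE// => z /=.
by rewrite !in_itv/= !andbT; exact: le_lt_trans.
Qed.

Lemma long_tailed_shift (t e : R) : 0 < e ->
  exists x0, forall x, x0 <= x -> 0 < tail F x /\ tail F x <= (1 + e) * tail F
    (x + t).
Proof.
move=> e0; have e1 : 0 < e / (1 + e) by rewrite divr_gt0//; lra.
have := F_long t => /cvgrPdist_lt /(_ _ e1) [M [_ hM]].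
exists (M + 1) => x xM; have /hM /= h : M < x by lra.
have Fx : 0 < tail F x.
  rewrite lt_neqAle tail_ge0 andbT eq_sym; apply/eqP => Fx0.
  move: h; rewrite Fx0 invr0 mulr0 subr0 normr1 ltr_pdivlMr; last by lra.
  by lra.
split=> //; have : 1 - e / (1 + e) < tail F (x + t) / tail F x.
  by move: h; rewrite ltr_norml => /andP[_]; lra.
have -> : 1 - e / (1 + e) = (1 + e)^-1 by field; lra.
rewrite ltr_pdivlMr// mulrC ltr_pdivrMr; last by lra.
by rewrite mulrC => /ltW.
Qed.

Lemma long_tailed_gt0 (x : R) : (0 < F (ray x))%E.
Proof.
have [x0 /(_ (Num.max x x0))] := long_tailed_shift 0 ltr01.
rewrite le_max lexx orbT => /(_ isT) [h _]; rewrite -tailE lte_fin.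
by rewrite (lt_le_trans h)// tail_ni// le_max lexx.
Qed.

End long_tails.

(** * Tails of subexponential laws *)

Section tail_limits.
Variables (R : realType) (G : probability R R).

Lemma integral_ray_tail (x : R) :
  (\int[G]_y (if (x < y)%R then 1 else 0) = (tail G x)%:E)%E.
Proof. by rewrite integral_ray tailE. Qed.

Lemma tail_small (e : R) : 0 < e ->
  exists2 x0 : R, 0 < x0 & forall x, x0 <= x -> tail G x <= e.
Proof.
move=> e0.
have [||||c c0 hc] := @tail_integral_small _ _ _ G id (cst 1%E) _ _ _ _ _ e0 => //.
  by rewrite (cst_integral G 1) ltry.
by exists c => // x cx; rewrite -lee_fin -integral_ray_tail hc.
Qed.

Hypothesis G_half_line : G `]-oo, 0[%classic = 0%E.

Lemma integral_lt0 : (\int[G]_y (if (y < 0)%R then 1 else 0) = 0)%E.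
Proof.
rewrite -[RHS]G_half_line -[in RHS](setIT `]-oo, 0[%classic) -integral_indic//.
apply: eq_integral => y _; rewrite indicE; case: ifPn => y0.
  by rewrite mem_set//= in_itv/=.
by rewrite memNset//= in_itv/=; exact/negP.
Qed.

Lemma convolution_ray (x : R) : convolution G G (ray x) =
  (\int[G]_r \int[G]_u (if (x < r + u)%R then 1 else 0))%E.
Proof.
have mk : measurable_fun [set: R * R] (fun p : R * R =>
    if (x < p.1 + p.2)%R then 1%E else 0%E : \bar R) by mfun.
rewrite -(fubini_tonelli1 (m1 := G) (m2 := G) (fun p : R * R =>
  if (x < p.1 + p.2)%R then 1%E else 0%E : \bar R))//; last by move=> p; case: ifP.
rewrite /convolution /pushforward -[LHS](congr1 (G \x G)%E (setIT _)).
rewrite -integral_indic//; last first.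
  rewrite -[X in measurable X]setTI.
  have h : measurable_fun [set: R * R] (fun p : R * R => p.1 + p.2) by mfun.
  exact: h.
apply: eq_integral => p _; rewrite indicE; case: ifPn => h.
  by rewrite mem_set//= in_itv/= h.
by rewrite memNset//= in_itv/= andbT; exact/negP.
Qed.

(** For independent X and Y of law G, the event X + Y > x has three disjoint
    parts: A < X <= x - A with X + Y > x, then X <= A with Y > x, then X > x
    with Y <= A. *)
Lemma convolution_split (A x : R) : 0 <= A -> A < x ->
  (\int[G]_r (if ((A < r) && (r <= x - A))%R then (tail G (x - r))%:E else 0)
    + (2 * (1 - tail G A) * tail G x)%:E <= convolution G G (ray x))%E.
Proof.
move=> A0 Ax.
have GA : (\int[G]_u (if ((0 <= u) && (u <= A))%R then 1 else 0) =
  (1 - tail G A)%:E)%E.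
  have : (\int[G]_u ((if ((0 <= u) && (u <= A))%R then 1 else 0) +
     (if (A < u)%R then 1 else 0) + (if (u < 0)%R then 1 else 0)) = 1%:E)%E.
    transitivity (\int[G]__ 1%:E)%E; last exact: cst_integral.
    apply: eq_integral => u _.
    have [u0|u0] := ltP u 0; have [Au|uA] := ltP A u => /=; rewrite ?adde0 ?add0e//.
    by have : False by lra.
  rewrite ge0_integralD//; last 4 first.
  - by move=> y _; rewrite adde_ge0//; case: ifP.
  - by mfun.
  - by move=> y _; case: ifP.
  - by mfun.
  rewrite integral_lt0 adde0 ge0_integralD//; last 4 first.
  - by move=> y _; case: ifP.
  - by mfun.
  - by move=> y _; case: ifP.
  - by mfun.
  by rewrite integral_ray_tail => h; rewrite EFinB -[X in (X - _)%E]h addeK.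
rewrite convolution_ray.
pose k1 (r u : R) : \bar R := if (A < r) && (r <= x - A) &&
  (x - r < u) then 1%E else 0%E.
pose k2 (r u : R) : \bar R := if (0 <= r) && (r <= A) && (x < u) then 1%E else 0%E.
pose k3 (r u : R) : \bar R := if (x < r) && ((0 <= u) &&
  (u <= A)) then 1%E else 0%E.
have k10 r u : (0 <= k1 r u)%E by rewrite /k1; case: ifP.
have k20 r u : (0 <= k2 r u)%E by rewrite /k2; case: ifP.
have k30 r u : (0 <= k3 r u)%E by rewrite /k3; case: ifP.
have mk1 : measurable_fun [set: R * R] (fun p => k1 p.1 p.2) by rewrite /k1; mfun.
have mk2 : measurable_fun [set: R * R] (fun p => k2 p.1 p.2) by rewrite /k2; mfun.
have mk3 : measurable_fun [set: R * R] (fun p => k3 p.1 p.2) by rewrite /k3; mfun.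
have m1 : measurable_fun [set: R] (fun r => \int[G]_u k1 r u)%E.
  exact: (measurable_fun_fubini_tonelli_F (m2 := G) (fun p : R * R => k1 p.1 p.2)).
have m2 : measurable_fun [set: R] (fun r => \int[G]_u k2 r u)%E.
  exact: (measurable_fun_fubini_tonelli_F (m2 := G) (fun p : R * R => k2 p.1 p.2)).
have m3 : measurable_fun [set: R] (fun r => \int[G]_u k3 r u)%E.
  exact: (measurable_fun_fubini_tonelli_F (m2 := G) (fun p : R * R => k3 p.1 p.2)).
have I10 r : (0 <= \int[G]_u k1 r u)%E by exact: integral_ge0.
have I20 r : (0 <= \int[G]_u k2 r u)%E by exact: integral_ge0.
have I30 r : (0 <= \int[G]_u k3 r u)%E by exact: integral_ge0.
have GA0 : 0 <= 1 - tail G A by rewrite subr_ge0 tail_le1.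
have E1 : (\int[G]_r \int[G]_u k1 r u =
    \int[G]_r (if ((A < r) && (r <= x - A))%R then (tail G (x - r))%:E else 0))%E.
  apply: eq_integral => r _; rewrite /k1; case: ifPn => _ /=.
    by rewrite integral_ray_tail.
  by rewrite integral0_eq.
have E2 : (\int[G]_r \int[G]_u k2 r u = ((1 - tail G A) * tail G x)%:E)%E.
  rewrite EFinM -GA -ge0_integralZr//; last 3 first.
  - by mfun.
  - by move=> r _; case: ifP.
  - by rewrite lee_fin tail_ge0.
  apply: eq_integral => r _; rewrite /k2; case: ifPn => _ /=.
    by rewrite integral_ray_tail mul1e.
  by rewrite mul0e integral0_eq.
have E3 : (\int[G]_r \int[G]_u k3 r u = ((1 - tail G A) * tail G x)%:E)%E.
  rewrite EFinM -[in RHS]integral_ray_tail -ge0_integralZl_EFin//; last 2 first.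
  - by move=> r _; case: ifP.
  - by mfun.
  apply: eq_integral => r _; rewrite /k3; case: ifPn => _ /=.
    by rewrite GA mule1.
  by rewrite mule0 integral0_eq.
have -> : 2 * (1 - tail G A) * tail G x =
  (1 - tail G A) * tail G x + (1 - tail G A) * tail G x by ring.
rewrite EFinD -{1}E2 -E3 -E1 addeA -!ge0_integralD//; last 2 first.
- by move=> r _; exact: adde_ge0.
- by mfun.
apply: ge0_le_integral => //.
- by move=> r _; apply: adde_ge0 => //; exact: adde_ge0.
- by mfun.
- apply: (measurable_fun_fubini_tonelli_F (m2 := G) (fun p : R * R =>
    if (x < p.1 + p.2)%R then 1%E else 0%E : \bar R)); first by mfun.
  by move=> p; case: ifP.
move=> r _.
have mr1 : measurable_fun [set: R] (k1 r) by rewrite /k1; mfun.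
have mr2 : measurable_fun [set: R] (k2 r) by rewrite /k2; mfun.
have mr3 : measurable_fun [set: R] (k3 r) by rewrite /k3; mfun.
rewrite -!ge0_integralD//; last 2 first.
- by move=> u _; exact: adde_ge0.
- by mfun.
apply: ge0_le_integral => //.
- by move=> u _; apply: adde_ge0 => //; exact: adde_ge0.
- by mfun.
- by mfun.
move=> u _; rewrite /k1 /k2 /k3.
have [Ar|rA] := ltP A r => /=.
  rewrite andbF adde0; have [rx|xr] := leP r (x - A) => /=.
    rewrite [X in (_ + X)%E]ifF ?adde0; last first.
      by apply/negbTE/negP => /andP[h _]; lra.
    by case: ifPn => h; [rewrite ifT//; lra|case: ifP].
  rewrite add0e; case: ifPn => [/andP[h1 /andP[h2 h3]]|_]; last by case: ifP.
  by rewrite ifT//; lra.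
rewrite add0e andbT [X in (_ + X)%E]ifF ?adde0; last first.
  by apply/negbTE/negP => /andP[h _]; lra.
case: ifPn => [/andP[h1 h2]|_]; last by case: ifP.
by rewrite ifT//; lra.
Qed.

End tail_limits.

(** * The upper bound *)

Section upper_bound.
Variables (R : realType) (F G : probability R R) (v : R -> R).
Local Notation m := (neg_tmean F).
Local Notation lam := (lebesgue_stieltjes_measure (neg_ratio F)).
Hypothesis infinite_mean : ('E_F[@neg_part R] = +oo)%E.
Hypothesis ratio_integrable :
  (\int[F]_(x in `]0%R, +oo[) (x / neg_tmean F x)%:E < +oo)%E.
Hypothesis F_long : long_tailed F.
Hypothesis G_tail : forall x : R, 0 <= x ->
  G (ray x) = mine 1%E (integrated_tail F x).
Hypothesis G_subexp : subexponential G.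
Hypothesis v_sup_tail : sup_tail F v.

Lemma tail_gt0 x : 0 < tail G x.
Proof. by case: G_subexp. Qed.

Lemma integrated_tail_eventually :
  exists2 x0 : R, 0 < x0 & forall x, x0 <= x -> integrated_tail F x = (tail G x)%:E.
Proof.
have e2 : (0 : R) < 1 / 2 by rewrite divr_gt0.
have [x0 x00 hx] := tail_small G e2.
exists x0 => // x xx; have h2 := hx _ xx.
have := G_tail (le_trans (ltW x00) xx); rewrite -tailE /mine.
case: ifPn => _ h; last by rewrite h.
by move: h => [h]; exfalso; rewrite h in h2; lra.
Qed.

(** Long-tailedness of F passes to its integrated tail by integrating the
    inequality between the tails at x - A + t and at x + t. *)
Lemma tail_shift_le (A e : R) : 0 <= A -> 0 < e ->
  exists2 x0 : R, 0 < x0 & forall x, x0 <= x -> tail G (x - A) <=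
    (1 + e) * tail G x.
Proof.
move=> A0 e0; have [x1 x10 hx1] := integrated_tail_eventually.
have [x2 hx2] := long_tailed_shift F_long A e0.
exists (Num.max x1 x2 + A); first by rewrite ltr_wpDr// lt_max x10.
move=> x xx; have h : Num.max x1 x2 <= x - A by lra.
have h1 : x1 <= x - A by apply: le_trans h; rewrite le_max lexx.
have h2 : x2 <= x - A by apply: le_trans h; rewrite le_max lexx orbT.
rewrite -lee_fin EFinM -!hx1//; last by lra.
have mt y : measurable_fun [set: measurableTypeR R] (fun t : R =>
  (tail F (y + t))%:E).
  apply/measurable_EFinP; apply: nonincreasing_measurable => // s t st.
  by rewrite tail_ni// lerD2l.
have mr : measurable (ray 0 : set (measurableTypeR R)) by exact: measurable_itv.
rewrite /integrated_tail.
under eq_integral do rewrite -tailE.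
under [X in (_ <= _ * X)%E]eq_integral do rewrite -tailE.
rewrite -ge0_integralZl_EFin//; last 3 first.
- by move=> t _; rewrite lee_fin tail_ge0.
- exact: measurable_funS (mt x).
- by rewrite addr_ge0// ltW.
apply: ge0_le_integral => //.
- by move=> t _; rewrite lee_fin tail_ge0.
- exact: measurable_funS (mt (x - A)).
- by apply: measurable_funeM; exact: measurable_funS (mt x).
move=> t /=; rewrite in_itv/= andbT => t0; rewrite -EFinM lee_fin.
have [|_] := hx2 (x - A + t); first by lra.
by rewrite (_ : x - A + t + A = x + t)//; ring.
Qed.

(** The remainder in ratio_tail_le is a multiple of the tail of F, which is
    negligible since integrated_tail_ge holds with a(T) arbitrarily large.
    *)
Lemma ratio_tail_eventually (e K t0 : R) : 0 < e -> 0 <= K ->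
  exists2 s0 : R, 0 < s0 & forall s, s0 <= s ->
    (\int[F]_y (if (s - K < y)%R then (ratio0 F (Num.max (y - s) t0))%:E else 0)
      <= ((1 + e) * tail G s)%:E)%E.
Proof.
move=> e0 K0; pose g0 := neg_ratio F 0.
pose C := ratio0 F t0 + (1 + e / 2) * g0.
have g00 : 0 <= g0 := neg_ratio0_ge0 F.
have C0 : 0 <= C by rewrite addr_ge0 ?ratio0_ge0// mulr_ge0//; lra.
have [T T0 hT] := ratio0_infty infinite_mean (4 * C / e + g0 + 1).
have {}hT := hT T (lexx T).
have [s1 s10 hs1] := integrated_tail_eventually.
have [s2 hs2] := long_tailed_shift F_long (K + T) ltr01.
exists (Num.max s1 s2 + K); first by rewrite ltr_wpDr// lt_max s10.
move=> s ss; have h : Num.max s1 s2 <= s - K by lra.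
have h1 : s1 <= s by apply: (@le_trans _ _ (Num.max s1 s2));
  [rewrite le_max lexx|lra].
have h2 : s2 <= s - K by apply: le_trans h; rewrite le_max lexx orbT.
have c1 : 1 < 1 + e / 2 by lra.
apply: (le_trans (ratio_tail_le infinite_mean _ _ c1 K0)).
rewrite hs1// -tailE -EFinM -EFinM -EFinD lee_fin -/g0 -/C.
have q0 : 0 <= 4 * C / e by rewrite divr_ge0 ?mulr_ge0// ltW.
have := @integrated_tail_ge _ F s T T0; rewrite -/g0 hs1// -tailE -EFinM lee_fin.
move=> /(_ ltac:(lra)) hI.
have [_] := hs2 _ h2; rewrite (_ : s - K + (K + T) = s + T); last by ring.
move=> hF; have FT := tail_ge0 F (s + T).
have : 4 * C / e * tail F (s + T) <= tail G s.
  by apply: le_trans hI; rewrite ler_wpM2r//; lra.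
rewrite mulrAC ler_pdivrMr// => hC.
have : C * tail F (s - K) <= C * ((1 + 1) * tail F (s + T)) by rewrite ler_wpM2l.
have := tail_ge0 G s.
by nra.
Qed.

(** The convolution tail is about 2 times the tail at x, and the two extreme
    parts of convolution_split already account for the factor 2 (1 - tail G
    A). *)
Lemma subexponential_middle (A e : R) : 0 <= A -> 0 < e ->
  exists2 x0 : R, 0 < x0 & forall x, x0 <= x ->
    (\int[G]_r (if ((A < r) && (r <= x - A))%R then (tail G (x - r))%:E else 0)
      <= ((2 * e + 2 * tail G A) * tail G x)%:E)%E.
Proof.
move=> A0 e0; have [G0 Gpos] := G_subexp.
move=> /cvgrPdist_lt /(_ _ e0) [M [_ hM]].
exists (Num.max (M + 1) (A + 1)); first by rewrite lt_max; apply/orP; right; lra.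
move=> x; rewrite ge_max => /andP[xM xA].
have := hM x; rewrite /= => /(_ ltac:(lra)) h.
have Ax : A < x by lra.
have := convolution_split G0 A0 Ax.
set I := (\int[G]_r _)%E.
have cf : convolution G G (ray x) \is a fin_num.
  rewrite convolution_ray (_ : (\int[G]_r _ = \int[G]_r (tail G (x - r))%:E)%E).
    have mt : measurable_fun [set: R] (tail G).
      by apply: nonincreasing_measurable => // y z yz; rewrite tail_ni.
    apply: (proj1 (@fin_num_integral_le _ G (fun r => tail G (x - r)) 1 _ _));
      first by mfun.
    by move=> r; rewrite tail_ge0 tail_le1.
  apply: eq_integral => r _; rewrite -integral_ray_tail; apply: eq_integral => u _.
  by rewrite ltrBlDl.
rewrite -leeBrDr// -(fineK cf) -EFinB => /le_trans; apply.
rewrite lee_fin; set c := fine _ in h *.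
have Gx := Gpos x.
have : c / (2 * tail G x) < 1 + e by move: h; rewrite ltr_norml => /andP[]; lra.
rewrite ltr_pdivrMr ?mulr_gt0// => hc.
by nra.
Qed.

(** The last term of stage_inequality carries the factor v K, and the middle one
    is a small multiple of q tail G x by subexponentiality. None of K, A and
    x0 depends on q. *)
Lemma upper_step (e k : R) : 0 < e -> e <= 1 -> 0 < k ->
  exists K A x0 : R, [/\ 0 < K, 0 <= A & forall x q, x0 <= x -> 0 <= q ->
    (forall y, A <= y -> y <= x - K -> v y <= q * tail G y) ->
    v x <= (2 + 10 * e + k * q) * tail G x].
Proof.
move=> e0 e1 k0; pose d := Num.min (e / 6) (k / 4).
have d0 : 0 < d by rewrite lt_min !divr_gt0.
(* The bound e / 6 on v(K) is for the Green function, k / 4 for the last term of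
   the stage inequality. *)
have [K K0 /(_ _ (lexx K)) vK] := sup_tail_small infinite_mean ratio_integrable
  (long_tailed_gt0 F_long) v_sup_tail d0.
have vKe : v K <= e / 6 by rewrite (le_trans vK)// ge_min lexx.
have vKk : v K <= k / 4 by rewrite (le_trans vK)// ge_min lexx orbT.
have hK : 2 + e / 2 <= (1 - v K) * (2 + e).
  by have := sup_tail_ge0 v_sup_tail K; nra.
have [t0 t00 ht0] := green_level_exists infinite_mean ratio_integrable
  (ltW K0) (ltW K0) e0 hK.
have [A1 A10 hA1] := ratio_tail_eventually t0 e0 (ltW K0).
have kk : 0 < k / 48 by rewrite divr_gt0.
have [A2 A20 hA2] := tail_small G kk.
pose A := Num.max K (Num.max A1 A2).
have KA : K <= A by rewrite le_max lexx.
have A1A : A1 <= A by rewrite !le_max lexx orbT.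
have A2A : A2 <= A by rewrite !le_max lexx !orbT.
have A0 : 0 < A by exact: lt_le_trans KA.
have [x1 x10 hx1] := tail_shift_le (ltW A0) e0.
have [x2 x20 hx2] := subexponential_middle (ltW A0) kk.
exists K, A, (Num.max (Num.max x1 x2) (A + A)); split => //; first exact: ltW.
move=> x q; rewrite !ge_max -andbA => /and3P[xx1 xx2 xA] q0 hv.
have stage := stage_inequality infinite_mean v_sup_tail e0
  (ltW K0) t00 ht0 KA _ q0 hv.
have {}stage := stage ltac:(lra).
have over s : A <= s -> (overshoot F v e K t0 s 0 <= (6 * tail G s)%:E)%E.
  move=> As; apply: (le_trans (overshoot0_le infinite_mean v_sup_tail e0
    (ltW K0) t00 _)).
  apply: (@le_trans _ _ ((2 + e)%:E * ((1 + e) * tail G s)%:E)%E).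
    by rewrite lee_wpmul2l ?lee_fin ?hA1//; lra.
  rewrite -EFinM lee_fin mulrA ler_wpM2r ?tail_ge0//.
  by nra.
have int2 : (\int[G]_r (if ((A < r) &&
  (r <= x - A))%R then overshoot F v e K t0 (x - r) 0 else 0)
    <= (6 * ((2 * (k / 48) + 2 * tail G A) * tail G x))%:E)%E.
  have mt : measurable_fun [set: R] (tail G).
    by apply: nonincreasing_measurable => // y z yz; rewrite tail_ni.
  have mo := measurable_overshoot infinite_mean v_sup_tail e0 (ltW K0) t00.
  rewrite EFinM; apply: (@le_trans _ _ (6%:E * \int[G]_r
      (if ((A < r) && (r <= x - A))%R then (tail G (x - r))%:E else 0))%E);
        last first.
    by rewrite lee_wpmul2l// hx2.
  rewrite -ge0_integralZl_EFin//; last 2 first.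
  - by move=> r _; case: ifP => // _; rewrite lee_fin tail_ge0.
  - by mfun.
  apply: ge0_le_integral => //.
  - move=> r _; case: ifP => // _;
    exact: (overshoot_ge0 v_sup_tail e0 (ltW K0) t00).
  - apply: measurable_fun_ifT; [by mfun| |exact: measurable_cst].
    have h : measurable_fun [set: R] (fun r : R => (x - r, 0 : R)).
      by apply: measurable_fun_pair; mfun.
    exact: (measurableT_comp mo h).
  - by mfun.
  move=> r _; case: ifPn => [/andP[Ar rx]|_]; last by rewrite mule0.
  by rewrite -EFinM over//; lra.
have int1 : (overshoot F v e K t0 (x - A) 0 <= ((2 + 10 * e) * tail G x)%:E)%E.
  apply: (le_trans (overshoot0_le infinite_mean v_sup_tail e0 (ltW K0) t00 _)).
  apply: (@le_trans _ _ ((2 + e)%:E * ((1 + e) * tail G (x - A))%:E)%E).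
    by rewrite lee_wpmul2l ?lee_fin ?hA1//; lra.
  rewrite -EFinM lee_fin;
    apply: (@le_trans _ _ ((2 + e) * ((1 + e) * ((1 + e) * tail G x)))).
    by rewrite ler_wpM2l ?ler_wpM2l ?hx1//; lra.
  rewrite !mulrA ler_wpM2r ?tail_ge0//.
  by nra.
have qlee := lee_wpmul2l (_ : (0 <= q%:E)%E) int2; rewrite lee_fin in qlee.
have := le_trans stage (leeD (leeD int1 (qlee q0)) (lexx _)).
rewrite -!EFinM -!EFinD lee_fin => /le_trans; apply.
have h2 := hA2 _ A2A; have h3 := hx1 _ xx1.
have Gx := tail_ge0 G x; have vK0 := sup_tail_ge0 v_sup_tail K.
have -> : (2 + 10 * e + k * q) * tail G x = (2 + 10 * e) * tail G x +
   q * (6 * ((k / 12) * tail G x)) + q * (k / 2 * tail G x) by field.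
apply: lerD; first (apply: lerD => //).
  by rewrite ler_wpM2l// ler_wpM2l// ler_wpM2r//; lra.
rewrite -[leLHS]mulrA ler_wpM2l//.
apply: (@le_trans _ _ (2 * tail G x * (k / 4))); last by lra.
apply: ler_pM => //; first exact: tail_ge0.
by apply: (le_trans h3); rewrite ler_wpM2r//; lra.
Qed.

(** The step is first used with k = 1 / 2, by induction on x in increments of K,
    to show v <= C tail G; then with k of order e / C. *)
Lemma sup_tail_upper (e : R) : 0 < e ->
  exists x0 : R, forall x, x0 <= x -> v x <= (2 + e) * tail G x.
Proof.
move=> e0; have half : (0 : R) < 1 / 2 by rewrite divr_gt0.
have [K [A [x1 [K0 A0 h1]]]] := upper_step ltr01 (lexx 1) half.
pose x1' := Num.max x1 0.
(* With e = 1 the step gives 12 + C / 2, which is at most C for C >= 24. *)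
pose C := Num.max 24 (tail G x1')^-1.
have C24 : 24 <= C by rewrite le_max lexx.
have C1 : 1 <= C * tail G x1'.
  have t0 := tail_gt0 x1'.
  apply: (@le_trans _ _ ((tail G x1')^-1 * tail G x1'));
    first by rewrite mulVf// gt_eqF.
  by rewrite ler_wpM2r ?(ltW t0)// le_max lexx orbT.
have claim (n : nat) x : x <= x1' + n%:R * K -> v x <= C * tail G x.
  elim: n x => [|n IH] x.
    rewrite mul0r addr0 => xx; apply: (le_trans (sup_tail_le1 v_sup_tail x)).
    by apply: (le_trans C1); rewrite ler_wpM2l ?tail_ni//; lra.
  rewrite -natr1 mulrDl mul1r => xn.
  have [xx|xx] := leP x x1'.
    apply: (le_trans (sup_tail_le1 v_sup_tail x)).
    by apply: (le_trans C1); rewrite ler_wpM2l ?tail_ni//; lra.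
  apply: (le_trans (h1 x C _ _ _)).
  - by apply: le_trans (ltW xx); rewrite le_max lexx.
  - by lra.
  - by move=> y _ yx; apply: IH; lra.
  by rewrite ler_wpM2r ?tail_ge0//; lra.
have vC x : v x <= C * tail G x.
  pose n := Num.bound (Num.max 0 ((x - x1') / K)).
  apply: (claim n); rewrite addrC -lerBlDr -ler_pdivrMr//.
  apply: (@le_trans _ _ (Num.max 0 ((x - x1') / K)));
    first by rewrite le_max lexx orbT.
  by apply/ltW/archi_boundP; rewrite le_max lexx.
pose e' := Num.min (e / 20) 1.
have e'0 : 0 < e' by rewrite lt_min ltr01 divr_gt0.
have e'1 : e' <= 1 by rewrite ge_min lexx orbT.
have e'e : e' <= e / 20 by rewrite ge_min lexx.
have k0 : 0 < e / (2 * C) by rewrite divr_gt0//; lra.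
have [K' [A' [x2 [_ _ h2]]]] := upper_step e'0 e'1 k0.
exists x2 => x xx; apply: (le_trans (h2 x C xx _ (fun y _ _ => vC y)));
  first by lra.
rewrite ler_wpM2r ?tail_ge0//.
have -> : e / (2 * C) * C = e / 2 by field; lra.
by lra.
Qed.

End upper_bound.

(** * The law of the supremum *)

Section lindley.
Context d (T : measurableType d) (R : realType) (P : probability T R).
Variables (xi : nat -> {RV P >-> R}) (F : probability R R).
Hypothesis xi_indep : mutually_independent xi.
Hypothesis xi_law : forall i, has_law (xi i) F.

(** Lindley recursion for the maximum of the partial sums of length at most n of
    the increments of index at least j. *)
Fixpoint walk_max (j n : nat) (w : T) : R :=
  if n is n'.+1 then Num.max 0 (xi j w + walk_max j.+1 n' w) else 0.

Lemma measurable_walk_max j n : measurable_fun [set: T] (walk_max j n).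
Proof.
elim: n j => [|n IH] j /=; first exact: measurable_cst.
have mj : measurable_fun [set: T] (xi j) by [].
by have mn := IH j.+1; mfun.
Qed.

HB.instance Definition _ j n :=
  isMeasurableFun.Build _ _ _ _ (walk_max j n) (measurable_walk_max j n).

Definition walk_max_law (n : nat) : probability R R :=
  distribution P (walk_max 0 n : {RV P >-> R}).

Definition past (J : seq nat) (A : nat -> set R) : set T :=
  \bigcap_(i in [set` J]) (xi i @^-1` A i).

Lemma measurable_past J A : (forall i, measurable (A i)) -> measurable (past J A).
Proof.
move=> mA; apply: fin_bigcap_measurable => // i _.
rewrite -[X in measurable X]setTI.
by have : measurable_fun [set: T] (xi i) by []; apply.
Qed.

(** Independence of the future from the past, in the form that goes through the
    induction on n: the past is an arbitrary cylinder of earlier increments,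
    and the law of the future does not depend on the starting index j. *)
Definition past_independent (n : nat) : Prop :=
  forall (j : nat) (J : seq nat) (A : nat -> set R) (B : set R),
  uniq J -> {in J, forall i, (i < j)%N} -> (forall i, measurable (A i)) ->
  measurable B ->
  P (past J A `&` walk_max j n @^-1` B) = (P (past J A) * walk_max_law n B)%E.

Lemma past_cons j J A C : j \notin J ->
  past (j :: J) (fun i => if i == j then C else A i) =
  past J A `&` xi j @^-1` C.
Proof.
move=> jJ; apply/seteqP; split => w /=.
  move=> h; split.
    move=> i /= iJ; have := h i; rewrite /= inE iJ orbT => /(_ isT).
    by case: eqP => // ij; move: jJ; rewrite -ij iJ.
  by have := h j; rewrite /= inE eqxx => /(_ isT).
move=> [h1 h2] i /=; rewrite inE; case: eqP => [-> _ //|_ /= iJ].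
exact: h1.
Qed.

(** The next increment is added to the cylinder; the formula on rectangles so
    obtained determines the measure on the plane. *)
Lemma past_pair_independent n : past_independent n ->
  forall (j : nat) (J : seq nat) (A : nat -> set R) (E : set (R * R)),
  uniq J -> {in J, forall i, (i < j)%N} -> (forall i, measurable (A i)) ->
  measurable E ->
  P (past J A `&` (fun w => (xi j w, walk_max j.+1 n w)) @^-1` E) =
  (P (past J A) * (F \x walk_max_law n) E)%E.
Proof.
move=> indep j J A E uJ Jj mA mE; have mC := measurable_past J mA.
have mxj : measurable_fun [set: T] (xi j) by [].
pose Z w := (xi j w, walk_max j.+1 n w).
have mZ : measurable_fun [set: T] Z.
  by apply: measurable_fun_pair => //; exact: measurable_walk_max.
have mZE : measurable (Z @^-1` E) by rewrite -[X in measurable X]setTI; exact: mZ.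
have Pf : P (past J A) \is a fin_num by exact: fin_num_measure.
have [PC0|PC0] := eqVneq (P (past J A)) 0%E.
  rewrite PC0 mul0e; apply/eqP; rewrite -measure_le0 -PC0.
  by apply: le_measure; rewrite ?inE//; exact: measurableI.
have c0 : 0 < fine (P (past J A)).
  by rewrite fine_gt0// lt0e PC0 measure_ge0 -ge0_fin_numE.
set c := fine (P (past J A)) in c0.
have jJ : j \notin J by apply/negP => /Jj; rewrite ltnn.
(* The law of the pair given the past, as a normalized restriction of P. *)
pose cn : {nonneg R} := NngNum (ltW (etrans (invr_gt0 c) c0)).
pose mu : {measure set T -> \bar R} := mrestr P mC.
pose nu : {measure set (R * R) -> \bar R} := mscale cn (pushforward mu Z).
pose mu' := nu mZ.
have rect A1 B1 : measurable A1 -> measurable B1 ->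
    mu' (A1 `*` B1) = (F A1 * walk_max_law n B1)%E.
  move=> mA1 mB1.
  have -> : mu' (A1 `*` B1) = ((c^-1)%:E *
      P (past (j :: J) (fun i => if i == j then A1 else A i) `&`
         walk_max j.+1 n @^-1` B1))%E.
    apply: (congr1 (fun S => (c^-1)%:E * P S)%E).
    by rewrite past_cons//; apply/seteqP; split => w /= [[]].
  rewrite indep//; last 3 first.
  - by rewrite /= jJ.
  - move=> i; rewrite inE => /orP[/eqP ->//|/Jj ij]; exact: ltnW.
  - by move=> i; case: ifP.
  have -> : P (past (j :: J) (fun i => if i == j then A1 else A i)) =
      (P (past J A) * F A1)%E.
    rewrite xi_indep; last 2 first.
    - by rewrite /= jJ.
    - by move=> i; case: ifP.
    rewrite big_cons eqxx muleC; congr (_ * _)%E; last exact: (xi_law j mA1).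
    rewrite xi_indep// big_seq [RHS]big_seq; apply: eq_bigr => i iJ.
    by rewrite ifF//; apply/negbTE/eqP => ij; move: jJ; rewrite -ij iJ.
  by rewrite -(fineK Pf) -/c !muleA -EFinM mulVf ?gt_eqF// mul1e.
have -> := product_measure_unique rect mE.
have -> : mu' E = ((c^-1)%:E * P (past J A `&` Z @^-1` E))%E.
  by apply: (congr1 (fun S => (c^-1)%:E * P S)%E); rewrite setIC.
by rewrite muleA -{1}(fineK Pf) -EFinM -/c mulfV ?gt_eqF// mul1e.
Qed.

Definition lindley (p : R * R) : R := Num.max 0 (p.1 + p.2).

Lemma measurable_lindley : measurable_fun [set: R * R] lindley.
Proof. by rewrite /lindley; mfun. Qed.

Lemma measurable_lindley_preimage B : measurable B -> measurable (lindley @^-1` B).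
Proof. by move=> mB; rewrite -[X in measurable X]setTI;
  exact: measurable_lindley. Qed.

Lemma past_nil A : past [::] A = setT.
Proof. by apply/seteqP; split => // w _ i. Qed.

Lemma walk_max_lawS_of n : past_independent n -> forall B, measurable B ->
  walk_max_law n.+1 B = (F \x walk_max_law n)%E (lindley @^-1` B).
Proof.
move=> indep B mB.
have := past_pair_independent indep (j := 0) (J := [::]) (A := fun=> setT)
  isT _ _ (measurable_lindley_preimage mB).
rewrite past_nil setTI probability_setT mul1e => <- //.
Qed.

Lemma past_independent_all n : past_independent n.
Proof.
elim: n => [|n IH] j J A B uJ Jj mA mB.
  have [B0|B0] := pselect (B 0).
    have -> : walk_max j 0 @^-1` B = setT by apply/seteqP; split.
    have -> : walk_max_law 0 B = P setT.
      by apply: (congr1 P); apply/seteqP; split.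
    by rewrite setIT probability_setT mule1.
  have -> : walk_max j 0 @^-1` B = set0 by apply/seteqP; split.
  have -> : walk_max_law 0 B = P set0.
    by apply: (congr1 P); apply/seteqP; split.
  by rewrite setI0 measure0 mule0.
rewrite walk_max_lawS_of//.
by rewrite -(past_pair_independent IH uJ Jj mA (measurable_lindley_preimage mB)).
Qed.

Lemma walk_max_lawS n B : measurable B ->
  walk_max_law n.+1 B = (F \x walk_max_law n)%E (lindley @^-1` B).
Proof. exact: (walk_max_lawS_of (past_independent_all n)). Qed.

Lemma walk_max_law_ray n x : 0 <= x -> walk_max_law n.+1 (ray x) =
  (\int[F]_y walk_max_law n (ray (x - y)))%E.
Proof.
move=> x0; rewrite walk_max_lawS//; apply: eq_integral => y _ /=.
congr (walk_max_law n _); apply/seteqP; split => z /=; rewrite /xsection /= inE /=.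
  by rewrite /lindley /= !in_itv/= !andbT lt_max ltNge x0 /=; lra.
by rewrite /lindley /= !in_itv/= !andbT lt_max ltNge x0 /=; lra.
Qed.

Lemma walk_max_gt j n w x : x < walk_max j n w <->
  exists2 k, (k <= n)%N & x < \sum_(i < k) xi (j + i)%N w.
Proof.
elim: n j x => [|n IH] j x /=.
  split => [x0|[k]]; first by exists 0%N => //; rewrite big_ord0.
  by rewrite leqn0 => /eqP ->; rewrite big_ord0.
rewrite lt_max; split.
  move=> /orP[x0|]; first by exists 0%N => //; rewrite big_ord0.
  rewrite -ltrBlDl => /IH[k kn h]; exists k.+1 => //.
  rewrite big_ord_recl addn0 -ltrBlDl (lt_le_trans h)// le_eqVlt.
  by apply/orP; left; apply/eqP/eq_bigr => i _; rewrite addSnnS.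
move=> [[|k]]; first by rewrite big_ord0 => _ ->.
rewrite ltnS => kn; rewrite big_ord_recl addn0 -ltrBlDl => h.
apply/orP; right; rewrite -ltrBlDl; apply/IH; exists k => //.
rewrite (lt_le_trans h)// le_eqVlt.
by apply/orP; left; apply/eqP/eq_bigr => i _; rewrite addSnnS.
Qed.

Lemma walk_supE x : [set w | (x%:E < walk_sup xi w)%E] =
  \bigcup_n (walk_max 0 n @^-1` ray x).
Proof.
apply/seteqP; split => w /=.
  move=> /ereal_sup_gt[_ [n _ <-]]; rewrite lte_fin => h; exists n => //=.
  by rewrite in_itv/= andbT; apply/walk_max_gt; exists n.
move=> [n _] /=; rewrite in_itv/= andbT => /walk_max_gt[k _ h].
apply: (@lt_le_trans _ _ (walk xi k w)%:E); first by rewrite lte_fin.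
by apply: ereal_sup_ubound; exists k.
Qed.

Lemma walk_max_homo : {homo walk_max 0 : n p / (n <= p)%N >-> forall w, n w <= p w}.
Proof.
move=> n p np w; rewrite leNgt; apply/negP => /walk_max_gt[k kn].
rewrite ltNge => /negP; apply; rewrite leNgt; apply/negP => h.
suff : walk_max 0 p w < walk_max 0 p w by rewrite ltxx.
by apply/walk_max_gt; exists k => //; exact: leq_trans np.
Qed.

Definition walk_sup_tail (x : R) : R :=
  fine (P [set w | (x%:E < walk_sup xi w)%E]).

Lemma walk_sup_tail_cvg x :
  walk_max_law n (ray x) @[n --> \oo] --> (walk_sup_tail x)%:E.
Proof.
have mX n : measurable (walk_max 0 n @^-1` ray x).
  rewrite -[X in measurable X]setTI.
  by apply: measurable_walk_max.
have mU : measurable (\bigcup_n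
  (walk_max 0 n @^-1` ray x)) by exact: bigcup_measurable.
rewrite /walk_sup_tail walk_supE fineK; last exact: fin_num_measure.
apply: (@nondecreasing_cvg_mu _ _ _ P (fun n => walk_max 0 n @^-1` ray x)) => //.
move=> n p np; apply/subsetPset => w /=; rewrite !in_itv/= !andbT => h.
exact: lt_le_trans (walk_max_homo np w).
Qed.

Lemma walk_max_law_nd x : {homo (fun n =>
  walk_max_law n (ray x)) : n p / (n <= p)%N >-> (n <= p)%E}.
Proof.
have mX n : measurable (walk_max 0 n @^-1` ray x).
  rewrite -[X in measurable X]setTI.
  by apply: measurable_walk_max.
move=> n p np; change (P (walk_max 0 n @^-1` ray x) <= P
  (walk_max 0 p @^-1` ray x))%E.
apply: le_measure; rewrite ?inE//.
move=> w /=; rewrite !in_itv/= !andbT => h.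
exact: lt_le_trans (walk_max_homo np w).
Qed.

Lemma walk_max_law_le x n : (walk_max_law n (ray x) <= (walk_sup_tail x)%:E)%E.
Proof.
have h := @walk_sup_tail_cvg x; rewrite -(cvg_lim _ h)//.
have := @ereal_nondecreasing_cvgn _ _ (walk_max_law_nd x).
move=> /(cvg_lim _) -> //; apply: ereal_sup_ubound; by exists n.
Qed.

Lemma walk_sup_tail_ni : {homo walk_sup_tail : x y /~ x <= y}.
Proof.
move=> x y yx; rewrite -lee_fin; have h := @walk_sup_tail_cvg x.
rewrite -(cvg_lim _ h)//; apply: lime_le; first by apply/cvg_ex; eexists; exact: h.
apply: nearW => n; apply: le_trans (walk_max_law_le y n).
apply: le_measure; rewrite ?inE// => w /=; rewrite !in_itv/= !andbT.
exact: le_lt_trans.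
Qed.

(** The laws of the maxima of n steps satisfy the recursion with equality, start
    from the indicator of x < 0 and increase to the law of M. *)
Lemma walk_sup_tail_sup_tail : sup_tail F walk_sup_tail.
Proof.
have mtail n : measurable_fun [set: R] (tail (walk_max_law n)).
  by apply: nonincreasing_measurable => // x y; exact: tail_ni.
have law0 x : x < 0 -> forall n, walk_max_law n (ray x) = 1%E.
  move=> x0 n; rewrite -(@probability_setT _ _ _ P); apply: (congr1 P).
  apply/seteqP; split => // w _ /=; rewrite in_itv/= andbT.
  by apply/walk_max_gt; exists 0%N => //; rewrite big_ord0.
split.
- move=> x; rewrite /walk_sup_tail fine_ge0//= -lee_fin.
  have := walk_max_law_le x; have h := @walk_sup_tail_cvg x.
  move=> _; rewrite -/(walk_sup_tail x) -(cvg_lim _ h)//.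
  apply: lime_le; first by apply/cvg_ex; eexists; exact: h.
  by apply: nearW => n; exact: probability_le1.
- move=> x x0; have h := @walk_sup_tail_cvg x; apply: EFin_inj.
  rewrite -(cvg_lim _ h)//; under eq_fun do rewrite (law0 x x0).
  exact: lim_cst.
- exact: walk_sup_tail_ni.
- move=> x x0.
  pose k n (y : R) := walk_max_law n (ray (x - y)).
  have mk n : measurable_fun [set: R] (k n).
    rewrite (_ : k n = fun y => (tail (walk_max_law n) (x - y))%:E).
      by have := mtail n => ?; mfun.
    by apply/funext => y; rewrite tailE.
  have k0 n y : setT y -> (0 <= k n y)%E by [].
  have knd y : setT y -> {homo k^~ y : n p / (n <= p)%N >-> (n <= p)%E}.
    by move=> _ n p; exact: walk_max_law_nd.
  rewrite (eq_integral (fun y => limn (k^~ y))); last first.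
    by move=> y _; apply/esym/cvg_lim => //; exact: walk_sup_tail_cvg.
  rewrite (monotone_convergence F measurableT mk k0 knd).
  apply: lime_le.
    apply: ereal_nondecreasing_is_cvgn => n p np; apply: ge0_le_integral => //.
    by move=> y _; exact: walk_max_law_nd.
  apply: nearW => n; rewrite -walk_max_law_ray//; exact: walk_max_law_le.
- move=> c w c0 mw w0 wc wge x.
  have claim n y : (walk_max_law n (ray y) <= w y)%E.
    elim: n y => [|n IH] y.
      have [yc|yc] := ltP y c;
        first by rewrite (le_trans _ (wc _ yc))// walk_max_law_le.
      rewrite (_ : walk_max_law 0 (ray y) = 0%E)//.
      rewrite -(measure0 P); apply: (congr1 P); apply/seteqP; split => // z /=.
      by rewrite in_itv/= andbT ltNge (le_trans c0).
    have [yc|yc] := ltP y c;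
      first by rewrite (le_trans _ (wc _ yc))// walk_max_law_le.
    rewrite walk_max_law_ray ?(le_trans c0)//; apply: le_trans (wge _ yc).
    have mt := mtail n.
    apply: ge0_le_integral => //.
    + rewrite (_ : (fun _ => _) = fun z => (tail (walk_max_law n) (y - z))%:E);
      first by mfun.
      by apply/funext => z; rewrite tailE.
    + have h : measurable_fun [set: R] (fun z : R => y - z) by mfun.
      exact: (measurableT_comp mw h).
  have h := @walk_sup_tail_cvg x; rewrite -(cvg_lim _ h)//.
  apply: lime_le; first by apply/cvg_ex; eexists; exact: h.
  by apply: nearW => n.
Qed.

End lindley.

(** * Limits inferior and superior at infinity *)

Section limits_at_infinity.
Variable R : realType.
Implicit Types f : R -> R.

Lemma limf_einf_pinfty_ge f (c : R) :
  (forall e, 0 < e -> exists x0, forall x, x0 <= x -> c - e <= f x) ->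
  (c%:E <= limf_einf (fun x => (f x)%:E) (pinfty_nbhs R))%E.
Proof.
move=> h; rewrite limf_einfE; apply/lee_subgt0Pr => e e0.
have [x0 hx] := h e e0.
apply: (@le_trans _ _ (ereal_inf ((fun x => (f x)%:E) @` ray x0))).
  apply: le_ereal_inf_tmp => _ [x /= + <-].
  by rewrite in_itv/= andbT -EFinB lee_fin => /ltW /hx.
apply: ereal_sup_ubound; exists (ray x0) => //.
by exists x0; split => [|x]; [exact: num_real|rewrite /= in_itv/= andbT].
Qed.

Lemma limf_esup_pinfty_le f (c : R) :
  (forall e, 0 < e -> exists x0, forall x, x0 <= x -> f x <= c + e) ->
  (limf_esup (fun x => (f x)%:E) (pinfty_nbhs R) <= c%:E)%E.
Proof.
move=> h; rewrite limf_esupE; apply/lee_addgt0Pr => e e0.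
have [x0 hx] := h e e0.
apply: (@le_trans _ _ (ereal_sup ((fun x => (f x)%:E) @` ray x0))).
  apply: ereal_inf_lbound; exists (ray x0) => //.
  by exists x0; split => [|x]; [exact: num_real|rewrite /= in_itv/= andbT].
apply: ge_ereal_sup => _ [x /= + <-].
by rewrite in_itv/= andbT -EFinD lee_fin => /ltW /hx.
Qed.

Lemma limf_einf_le_esup (f : R -> \bar R) :
  (limf_einf f (pinfty_nbhs R) <= limf_esup f (pinfty_nbhs R))%E.
Proof.
rewrite limf_einfE limf_esupE; apply: ge_ereal_sup => _ [V FV <-].
apply: le_ereal_inf_tmp => _ [W FW <-].
have [x [Vx Wx]] : (V `&` W) !=set0.
  by apply: (@filter_ex _ (pinfty_nbhs R)); exact: filterI.
apply: (@le_trans _ _ (f x)).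
  by apply: ereal_inf_lbound; exists x.
by apply: ereal_sup_ubound; exists x.
Qed.

End limits_at_infinity.

Theorem theorem1 (R : realType) (d : measure_display) (T : measurableType d)
    (P : probability T R) (xi : nat -> {RV P >-> R})
    (F : probability R R) (G1 : probability R R)
    (xi_indep : mutually_independent xi)
    (xi_law : forall i, has_law (xi i) F)
    (F_nondeg : nondegenerate_law F)
    (neg_infinite_mean : ('E_F[@neg_part R] = +oo)%E)
    (M_cond : (\int[F]_(x in `]0%R, +oo[) (x / neg_tmean F x)%:E < +oo)%E)
    (F_long : long_tailed F)
    (G1_half_line : G1 `]-oo, 0[%classic = 0%E)
    (G1_tail : forall x : R, 0 <= x ->
       G1 `]x, +oo[%classic =
         mine 1%E (\int[lebesgue_stieltjes_measure (neg_ratio F)]_(t in `]0%R, +oo[)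
                     F `](x + t)%R, +oo[%classic)%E)
    (G1_subexp : subexponential G1) :
  let ratio (x : R) :=
    (fine (P [set w | (x%:E < walk_sup xi w)%E]) / tail G1 x)%:E in
  [/\ (1%:E <= limf_einf ratio (pinfty_nbhs R))%E,
      (limf_einf ratio (pinfty_nbhs R) <= limf_esup ratio (pinfty_nbhs R))%E
    & (limf_esup ratio (pinfty_nbhs R) <= 2%:E)%E].
Proof.
move=> ratio; pose v := walk_sup_tail xi.
have v_sup_tail : sup_tail F v := walk_sup_tail_sup_tail xi_indep xi_law.
have G1_gt0 : forall x, 0 < tail G1 x by case: G1_subexp.
split; last first.
- apply: (@limf_esup_pinfty_le _ (fun x => v x / tail G1 x)) => e e0.
  have [x0 hx] := sup_tail_upper neg_infinite_mean M_cond F_long G1_tail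
    G1_subexp v_sup_tail e0.
  by exists x0 => x /hx; rewrite ler_pdivrMr.
- exact: limf_einf_le_esup.
apply: (@limf_einf_pinfty_ge _ (fun x => v x / tail G1 x)) => e e0.
have [x0 x00 hx] := tail_small G1 e0.
exists x0 => x xx; have x0' : 0 <= x by apply: le_trans xx; exact: ltW.
have lower := sup_tail_lower neg_infinite_mean M_cond (long_tailed_gt0 F_long)
  v_sup_tail x0'.
have h_fin := jump_mean_fin neg_infinite_mean M_cond 0 x0'.
rewrite jump_mean0 in h_fin.
set h := fine _ in lower.
have gh : tail G1 x <= h.
  rewrite -lee_fin tailE /h fineK// G1_tail//.
  apply: (le_trans _ (integrated_tail_le neg_infinite_mean x)).
  by rewrite ge_min lexx orbT.
have g0 := G1_gt0 x; have ge := hx _ xx.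
have v0 := sup_tail_ge0 v_sup_tail x; have v1 := sup_tail_le1 v_sup_tail x.
rewrite ler_pdivlMr//.
have : h * (1 - v x) <= v x by lra.
have : tail G1 x * (1 - v x) <= h * (1 - v x) by rewrite ler_wpM2r//; lra.
by nra.
Qed.
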